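(* Let $G=(V,E)$ be a finite connected graph without multiple edges and self-loops, in which every vertex has degree at least $2$. Then for all $z\in\mathbb{C}\setminus\mathbb{R}$, $$\prod_{e\in E}(-G^z(e))\cdot\det\left((\zeta^z)^{-1}I^{|B|}-\mathcal{B}\right)=\det\left(zI^{|V|}-\mathcal{A}\right)\cdot\prod_{x\in V}(-G^z(x)).$$
   Context: $\mathcal{A}$ is the adjacency matrix of $G$: $\mathcal{A}f(x)=\sum_{y\sim x}f(y)$ for $f\in\mathbb{C}^V$, where $y\sim x$ means that $y$ is a neighbour of $x$. $B$ is the set of oriented edges of $G$ (each edge of $E$ gives two oriented edges); $e=(w,v)\in B$ has origin $o(e)=w$ and terminus $t(e)=v$. For $e,e'\in B$, $e'\leadsto e$ means that $t(e')=o(e)$ and $e$ is not the reverse of $e'$. The operator $\mathcal{B}$ on $\mathbb{C}^B$ is $\mathcal{B}f(e)=\sum_{e'\leadsto e}f(e')$. $I^{|B|}$ and $I^{|V|}$ are the identity operators on $\mathbb{C}^B$ and $\mathbb{C}^V$. Let $T=(V(T),E(T))$ be the universal cover of $G$, a tree with $G=\Gamma\backslash T$ for a subgroup $\Gamma$ of the automorphism group of $T$ acting without fixed points on $V(T)$. Let $\tilde{\mathcal{A}}$ be the adjacency operator of $T$ on $\ell^2(V(T))$, and for $z\in\mathbb{C}\setminus\mathbb{R}$ and $x,y\in V(T)$ let $G(x,y;z)=\langle\delta_x,(\tilde{\mathcal{A}}-z)^{-1}\delta_y\rangle_{\ell^2(V(T))}$ be its Green function (equivalently, the $(x,y)$ matrix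 entry of $(\tilde{\mathcal A}-z)^{-1}$). For neighbouring $v,w\in V(T)$, let $T^{(v|w)}$ be the tree obtained from $T$ by removing the branch emanating from $v$ that passes through $w$ (i.e. the connected component containing $v$ of $T$ with the edge $\{v,w\}$ removed). Let $G^{(v|w)}(\cdot,\cdot;z)$ be the Green function of the restriction of $\tilde{\mathcal{A}}$ to $T^{(v|w)}$, i.e. of the operator with matrix entries $\tilde{\mathcal{A}}(x,y)$ if $x,y\in T^{(v|w)}$ and zero otherwise. For $z\in\mathbb{C}\setminus\mathbb{R}$, $v\in V$ and $w$ a neighbour of $v$ in $G$, let $(\tilde v,\tilde w)$ be a lift of the edge $(v,w)$ to $T$, and set $$G^z(v)=G(\tilde v,\tilde v;z),\qquad \zeta^z(w,v)=-G^{(\tilde v|\tilde w)}(\tilde v,\tilde v;z);$$ these do not depend on the choice of lifts. For $e=(w,v)\in B$ set $G^z(e)=G(\tilde w,\tilde v;z)$ and $\zeta^z(e)=\zeta^z(w,v)$. The function $G^z(e)$ is invariant under edge reversal, so it is well defined for $e\in E$. The function $\zeta^z$ on $B$ (and $(\zeta^z)^{-1}$) acts on $\mathbb{C}^B$ as a multiplication operator, i.e. diagonally in the canonical basis. *)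

(* Defs.v *)
From HB Require Import structures.
From mathcomp Require Import all_boot all_order all_algebra.
From mathcomp Require Import complex.
From mathcomp Require Import all_classical all_reals all_analysis.

Set Implicit Arguments.
Unset Strict Implicit.
Unset Printing Implicit Defensive.

Import Order.TTheory GRing.Theory Num.Theory.

Local Open Scope classical_set_scope.
Local Open Scope ring_scope.
Local Open Scope complex_scope.

(* Graphs are given by their adjacency relation, so multiple edges cannot
   occur. [X] may be infinite. *)
Definition simple_graph (X : Type) (r : rel X) : Prop :=
  symmetric r /\ irreflexive r.

Definition reachable (X : eqType) (r : rel X) (x y : X) : Prop :=
  exists s : seq X, path r x s /\ last x s = y.

Definition connected_graph (X : eqType) (r : rel X) : Prop :=
  forall x y : X, reachable r x y.

(* A [ucycle] of size at most 2 is not a cycle of the graph: a pair of adjacent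
   vertices [:: x; y] is one. *)
Definition acyclic_graph (X : eqType) (r : rel X) : Prop :=
  forall c : seq X, (2 < size c)%N -> ~ ucycle r c.

Definition tree (X : eqType) (r : rel X) : Prop :=
  [/\ simple_graph r, connected_graph r & acyclic_graph r].

Definition covering_map (X V : Type) (r : rel X) (e : rel V) (p : X -> V) :=
  [/\ forall v, exists x, p x = v,
      forall x y, r x y -> e (p x) (p y) &
      forall x w, e (p x) w -> exists! y, r x y /\ p y = w].

(* The universal cover of a connected graph is its covering by a tree; it is
   unique up to isomorphism of coverings. *)
Definition universal_cover (X V : eqType) (r : rel X) (e : rel V) (p : X -> V)
    : Prop :=
  tree r /\ covering_map r e p.

Section GreenFunction.
Variables (R : realType) (X : choiceType).
Local Notation C := R[i].

Definition ell2 (f : X -> C) : Prop :=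
  (\esum_(x in [set: X]) (Normc.normc (f x) ^+ 2)%:E < +oo)%E.

Definition delta (x : X) : X -> C := fun y => (y == x)%:R.

(* The operator whose (x, y) matrix entry is 1 if [r x y] holds and 0 otherwise.
   The sum is a [fsbigop], so it is the expected one only when every x has
   finitely many y with [r x y]. *)
Definition adj_op (r : X -> X -> Prop) (f : X -> C) : X -> C :=
  fun x => \sum_(y \in [set y | r x y]) f y.

(* (H - z)^-1 as an operator on l^2(X): the preimage of [f] in l^2(X), unique
   when H - z is invertible on l^2(X). The value is 0 if there is none. *)
Definition resolvent (H : (X -> C) -> X -> C) (z : C) (f : X -> C) : X -> C :=
  xget (fun=> 0) [set g | ell2 g /\ forall x, H g x - z * g x = f x].

Definition green (r : X -> X -> Prop) (x y : X) (z : C) : C :=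
  resolvent (adj_op r) z (delta y) x.

Definition del_edge (r : rel X) (v w : X) : rel X :=
  fun x y => r x y && ((x, y) != (v, w)) && ((x, y) != (w, v)).

(* The vertex set of T^(v|w). *)
Definition branch (r : rel X) (v w : X) : set X :=
  [set x | reachable (del_edge r v w) v x].

(* G^(v|w), the Green function on l^2(X) of the operator with matrix entries
   those of the adjacency operator on T^(v|w) and 0 elsewhere. *)
Definition green_branch (r : rel X) (v w x y : X) (z : C) : C :=
  green (fun a b => [/\ branch r v w a, branch r v w b & r a b]) x y z.

End GreenFunction.

(* The quantities on [V] below are defined by selecting a lift through [p]. All
   lifts give the same value, so the selection is immaterial. The argument
   (w, v) of [G_arc] and [zeta] is the oriented edge with origin w and
   terminus v. *)
Section Lifted.
Variables (R : realType) (V : finType) (X : choiceType).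
Variables (r : rel X) (p : X -> V) (z : R[i]).

Definition G_vertex (v : V) : R[i] :=
  xget 0 [set c | exists2 x, p x = v & c = green r x x z].

Definition G_arc (b : V * V) : R[i] :=
  xget 0 [set c | exists x y,
    [/\ r x y, (p x, p y) = b & c = green r x y z]].

Definition zeta (b : V * V) : R[i] :=
  xget 0 [set c | exists x y,
    [/\ r x y, (p x, p y) = b & c = - green_branch r y x y y z]].

(* [E] is an unordered edge; [G_arc] is invariant under edge reversal. *)
Definition G_edge (E : {set V}) : R[i] :=
  xget 0 [set c | exists x y, [/\ r x y, [set p x; p y]%SET = E &
    c = G_arc (p x, p y)]].

End Lifted.

Section FiniteGraph.
Variables (R : realType) (V : finType) (e : rel V).
Local Notation C := R[i].

Definition edges : {set {set V}} :=
  [set [set b.1; b.2] | b : V * V & e b.1 b.2]%SET.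

Definition oriented_edge := {b : V * V | e b.1 b.2}.

Definition leadsto (b' b : oriented_edge) : bool :=
  ((val b').2 == (val b).1) && (val b != ((val b').2, (val b').1)).

Definition vertex_op (f : V -> C) : V -> C := fun x => \sum_(y | e x y) f y.

Definition nonbacktracking_op (f : oriented_edge -> C) : oriented_edge -> C :=
  fun b => \sum_(b' | leadsto b' b) f b'.

End FiniteGraph.

(* The determinant of a linear operator on C^K, computed in the canonical
   basis. *)
Definition det_op (R : realType) (K : finType) (L : (K -> R[i]) -> K -> R[i])
    : R[i] :=
  \det (\matrix_(i < #|K|, j < #|K|) L (delta R (enum_val j)) (enum_val i)).

(* Main.v *)
Require Import Defs.
From mathcomp Require Import all_boot all_order all_algebra.
From mathcomp Require Import complex.
From mathcomp Require Import all_classical all_reals all_analysis.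
From mathcomp Require Import zify ring lra.

Set Implicit Arguments.
Unset Strict Implicit.
Unset Printing Implicit Defensive.

Import Order.TTheory GRing.Theory Num.Theory.
Local Open Scope ring_scope.
Local Open Scope complex_scope.

(** Let [S v = z - \sum_(u ~ v) zeta (v, u)]. On the universal cover,
    [zeta (w, v) * (S v + zeta (v, w)) = 1], [G v = - 1 / S v] and
    [G (w, v) = - zeta (w, v) / S w].  Let [J] reverse arcs and let [(T f) v] be
    the sum of [f] over the arcs ending at [v], [(U h) b = h (o b)]. Then
    [zeta^-1 - B = (zeta^-1 + J) - U T], where [zeta^-1 + J] is block diagonal
    with one 2 x 2 block of determinant [- 1 / G e] for each edge [e], and
    [1 - T (zeta^-1 + J)^-1 U = S^-1 (z - A)]; Sylvester's identity
    [det (1 - P Q) = det (1 - Q P)] gives the theorem.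

    The equations for [zeta] close up on the finite set of arcs. Their solution
    with values in a half-plane is obtained there as the fixed point of a
    contraction of the hyperbolic metric. On the tree, products of [zeta] along
    paths from a root then solve the resolvent equation, and taking imaginary
    parts in the recursion bounds their l^2 norm. As the l^2 solution is unique,
    the Green functions of the tree are these products; in particular they depend
    only on the projection of their arguments to [V]. *)

(** * The arc weights *)

Section ComplexParts.
Variable R : rcfType.
Implicit Types (a b x y : R[i]) (t s : R).

Lemma ReD x y : complex.Re (x + y) = complex.Re x + complex.Re y.
Proof. by case: x y => [? ?] [? ?]. Qed.
Lemma ImD x y : complex.Im (x + y) = complex.Im x + complex.Im y.
Proof. by case: x y => [? ?] [? ?]. Qed.
Lemma ReN x : complex.Re (- x) = - complex.Re x.
Proof. by case: x. Qed.
Lemma ImN x : complex.Im (- x) = - complex.Im x.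
Proof. by case: x. Qed.
Lemma ReM x y : complex.Re (x * y) =
  complex.Re x * complex.Re y - complex.Im x * complex.Im y.
Proof. by case: x y => [? ?] [? ?]. Qed.
Lemma ImM x y : complex.Im (x * y) =
  complex.Re x * complex.Im y + complex.Im x * complex.Re y.
Proof. by case: x y => [? ?] [? ?]. Qed.
Lemma Im_sum (I : Type) (s : seq I) (P : pred I) (f : I -> R[i]) :
  complex.Im (\sum_(i <- s | P i) f i) = \sum_(i <- s | P i) complex.Im (f i).
Proof. by apply: (big_morph _ ImD). Qed.
Lemma Re_sum (I : Type) (s : seq I) (P : pred I) (f : I -> R[i]) :
  complex.Re (\sum_(i <- s | P i) f i) = \sum_(i <- s | P i) complex.Re (f i).
Proof. by apply: (big_morph _ ReD). Qed.

Definition nsq x : R := complex.Re x ^+ 2 + complex.Im x ^+ 2.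

Lemma nsqE x : nsq x = Normc.normc x ^+ 2.
Proof. by case: x => a b; rewrite /nsq /= sqr_sqrtr // addr_ge0 ?sqr_ge0. Qed.

Lemma nsq_ge0 x : 0 <= nsq x.
Proof. by rewrite addr_ge0 ?sqr_ge0. Qed.

Lemma nsqM x y : nsq (x * y) = nsq x * nsq y.
Proof. by rewrite /nsq ReM ImM; ring. Qed.

Lemma nsqN x : nsq (- x) = nsq x.
Proof. by rewrite /nsq ReN ImN !sqrrN. Qed.

Lemma nsq1 : nsq 1 = 1.
Proof. by rewrite /nsq /= expr1n expr0n addr0. Qed.

Lemma nsq0 : nsq 0 = 0.
Proof. by rewrite /nsq /= expr0n addr0. Qed.

Lemma nsq_eq0 x : (nsq x == 0) = (x == 0).
Proof.
by case: x => a b; rewrite /nsq /= paddr_eq0 ?sqr_ge0 // !sqrf_eq0 eq_complex.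
Qed.

Lemma nsqV x : nsq x^-1 = (nsq x)^-1.
Proof.
have [->|x0] := eqVneq x 0; first by rewrite invr0 nsq0 invr0.
apply: (mulIf (x := nsq x)); first by rewrite nsq_eq0.
by rewrite -nsqM !mulVf ?nsq_eq0 // nsq1.
Qed.

Lemma ImV x : complex.Im x^-1 = - complex.Im x / nsq x.
Proof. by case: x => a b; rewrite mulNr. Qed.

Lemma Im_neq0 x : complex.Im x != 0 -> x != 0.
Proof. by apply: contra_neq => ->. Qed.

Lemma Im_sqr_le x : complex.Im x ^+ 2 <= nsq x.
Proof. by rewrite /nsq lerDr sqr_ge0. Qed.

Lemma Re_sqr_le x : complex.Re x ^+ 2 <= nsq x.
Proof. by rewrite /nsq lerDl sqr_ge0. Qed.

Lemma ler_of_sqr s t : 0 <= t -> s ^+ 2 <= t ^+ 2 -> s <= t.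
Proof.
move=> t0; have [s0 _|s0] := ltP s 0; first exact: le_trans (ltW s0) t0.
by rewrite ler_pXn2r.
Qed.

Lemma norm_le_of_sqr s t : 0 <= t -> s ^+ 2 <= t ^+ 2 -> `|s| <= t.
Proof. by move=> t0 st; apply: ler_of_sqr => //; rewrite real_normK ?num_real. Qed.

(** The cross term satisfies [c ^+ 2 <= nsq x * nsq y] by Cauchy-Schwarz, and the geometric mean of
    [A * b] and [a * B] is at most their arithmetic mean. Both are used in squared form. *)
Lemma nsqD_weighted (x y : R[i]) (t A B a b : R) :
  0 <= t -> 0 <= A -> 0 <= B -> 0 <= a -> 0 <= b ->
  nsq x <= t * (A * B) -> nsq y <= t * (a * b) ->
  nsq (x + y) <= t * ((A + a) * (B + b)).
Proof.
move=> t0 A0 B0 a0 b0 hx hy.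
pose c := complex.Re x * complex.Re y + complex.Im x * complex.Im y.
have -> : nsq (x + y) = nsq x + nsq y + 2 * c by rewrite /nsq ReD ImD /c; ring.
suff h : 2 * c <= t * (A * b + a * B) by lra.
apply: ler_of_sqr; first by rewrite mulr_ge0 // addr_ge0 ?mulr_ge0.
have h1 : c ^+ 2 <= nsq x * nsq y.
  rewrite -subr_ge0.
  have -> : nsq x * nsq y - c ^+ 2 =
    (complex.Re x * complex.Im y - complex.Im x * complex.Re y) ^+ 2.
    by rewrite /nsq /c; ring.
  exact: sqr_ge0.
have h2 : nsq x * nsq y <= t * (A * B) * (t * (a * b)).
  by rewrite ler_pM ?nsq_ge0.
have h3 : 0 <= (t * (A * b - a * B)) ^+ 2 := sqr_ge0 _.
have -> : (2 * c) ^+ 2 = 4 * c ^+ 2 by ring.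
have -> : (t * (A * b + a * B)) ^+ 2 =
  4 * (t * (A * B) * (t * (a * b))) + (t * (A * b - a * B)) ^+ 2 by ring.
by lra.
Qed.

(* Cauchy-Schwarz, stated without square roots. *)
Lemma nsq_sum_weighted (I : Type) (s : seq I) (P : pred I) (d : I -> R[i])
    (f g : I -> R) (t : R) :
  0 <= t -> (forall i, 0 <= f i) -> (forall i, 0 <= g i) ->
  (forall i, nsq (d i) <= t * (f i * g i)) ->
  nsq (\sum_(i <- s | P i) d i) <=
    t * ((\sum_(i <- s | P i) f i) * (\sum_(i <- s | P i) g i)).
Proof.
move=> t0 f0 g0 h; elim: s => [|i s IH]; first by rewrite !big_nil nsq0 mul0r mulr0.
rewrite !big_cons; case: (P i) => //.
by apply: nsqD_weighted => //; apply: sumr_ge0.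
Qed.

Lemma nsqB_le x y (c : R) : 0 <= c ->
  `|complex.Re x| <= c -> 0 <= complex.Im x <= c ->
  `|complex.Re y| <= c -> 0 <= complex.Im y <= c ->
  nsq (x - y) <= 5 * c ^+ 2.
Proof.
move=> c0; rewrite !ler_norml => /andP[? ?] /andP[? ?] /andP[? ?] /andP[? ?].
rewrite /nsq ReD ImD ReN ImN.
(* The real parts lie in an interval of length [2 * c], the imaginary parts in one of length [c]. *)
have -> : 5 * c ^+ 2 = (2 * c) ^+ 2 + c ^+ 2 by ring.
apply: lerD; rewrite -real_normK ?num_real // ler_pXn2r ?nnegrE ?mulr_ge0 //.
  by rewrite ler_norml; apply/andP; split; lra.
by rewrite ler_norml; apply/andP; split; lra.
Qed.

End ComplexParts.

(** * Limits of complex sequences, taken part by part *)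

Section GeometricLimit.
Import numFieldNormedType.Exports.
Variable R : realType.
Local Open Scope classical_set_scope.

Lemma cvg_geometric_increments (u : nat -> R) (c q : R) :
  0 <= c -> 0 <= q < 1 -> (forall n, `|u n.+1 - u n| <= c * q ^+ n) -> cvgn u.
Proof.
move=> c0 /andP[q0 q1] hu.
have hs : cvgn (series (telescope u)).
  apply: normed_cvg; apply: (@series_le_cvg _ _ (geometric c q)) => //=.
  - by move=> n; rewrite mulr_ge0 ?exprn_ge0.
  - by apply: is_cvg_geometric_series; rewrite ger0_norm.
rewrite (_ : u = fun n => u 0%N + series (telescope u) n).
  by apply: is_cvgD => //; apply: is_cvg_cst.
by apply/funext => n; exact: eq_sum_telescope.
Qed.

Definition ccvg (u : nat -> R[i]) (l : R[i]) :=
  ((fun n => complex.Re (u n)) @ \oo --> complex.Re l) /\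
  ((fun n => complex.Im (u n)) @ \oo --> complex.Im l).

Lemma ccvg_cst l : ccvg (fun=> l) l.
Proof. by split; apply: cvg_cst. Qed.

Lemma ccvgD u v l k : ccvg u l -> ccvg v k -> ccvg (fun n => u n + v n) (l + k).
Proof.
move=> [ur ui] [vr vi]; split.
  by rewrite ReD; under eq_cvg do rewrite ReD; apply: cvgD.
by rewrite ImD; under eq_cvg do rewrite ImD; apply: cvgD.
Qed.

Lemma ccvgM u v l k : ccvg u l -> ccvg v k -> ccvg (fun n => u n * v n) (l * k).
Proof.
move=> [ur ui] [vr vi]; split.
  by rewrite ReM; under eq_cvg do rewrite ReM; apply: cvgB; apply: cvgM.
by rewrite ImM; under eq_cvg do rewrite ImM; apply: cvgD; apply: cvgM.
Qed.

Lemma ccvg_sum (I : Type) (s : seq I) (P : pred I) (u : I -> nat -> R[i])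
    (l : I -> R[i]) : (forall i, ccvg (u i) (l i)) ->
  ccvg (fun n => \sum_(i <- s | P i) u i n) (\sum_(i <- s | P i) l i).
Proof.
move=> h; elim: s => [|i s IH].
  by rewrite big_nil; under eq_fun do rewrite big_nil; apply: ccvg_cst.
rewrite big_cons; under eq_fun do rewrite big_cons; case: (P i) => //.
exact: ccvgD.
Qed.

Lemma ccvg_unique u l k : ccvg u l -> ccvg u k -> l = k.
Proof.
move=> [ur ui] [vr vi]; apply/eqP; rewrite eq_complex.
by rewrite (cvg_unique _ ur vr) // (cvg_unique _ ui vi) // !eqxx.
Qed.

Lemma ccvgS u l : ccvg u l -> ccvg (fun n => u n.+1) l.
Proof.
move=> [ur ui]; split.
  by rewrite (cvg_shiftS (fun n => complex.Re (u n))).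
by rewrite (cvg_shiftS (fun n => complex.Im (u n))).
Qed.

End GeometricLimit.

(** * The fixed point in the upper half-plane *)

Section HerglotzFixedPoint.
Import numFieldNormedType.Exports.
Variables (R : realType) (V : finType) (e : rel V) (z : R[i]).
Hypothesis z_gt0 : 0 < complex.Im z.
Local Notation C := R[i].
Local Notation eta := (complex.Im z).

(** The unknown is [m = - zeta], so that [m] lies in the upper half-plane and the recursion reads
    [m = step m]. *)
Let ups (m : V * V -> C) (b : V * V) : C :=
  z + \sum_(u | e b.2 u && (u != b.1)) m (b.2, u).
Let step (m : V * V -> C) (b : V * V) : C := - (ups m b)^-1.

(** [M] bounds [step m] because [ups m b] has modulus at least [eta]. A sum in [ups] has at most [N]
    terms with parts bounded by [M], so [K2] bounds [nsq (ups m b)], and [eps] bounds the imaginary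
    part of [step m] from below. *)
Let M : R := eta^-1.
Let N : R := #|V|%:R.
Let K2 : R := (`|complex.Re z| + N * M) ^+ 2 + (eta + N * M) ^+ 2.
Let eps : R := eta / K2.

Let M_gt0 : 0 < M. Proof. by rewrite invr_gt0. Qed.
Let NM_ge0 : 0 <= N * M. Proof. by rewrite mulr_ge0 ?ler0n ?ltW. Qed.
Let K2_gt0 : 0 < K2.
Proof.
rewrite /K2 ltr_wpDl ?sqr_ge0 // exprn_gt0 //.
by rewrite (lt_le_trans z_gt0) // lerDl.
Qed.
Let eps_gt0 : 0 < eps. Proof. by rewrite divr_gt0. Qed.

(** [weak] admits real values, in particular the starting point 0. One [step] leads from [weak] into
    [dom], which stays away from the real axis. *)
Let weak (m : V * V -> C) := forall b,
  `|complex.Re (m b)| <= M /\ 0 <= complex.Im (m b) <= M.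
Let dom (m : V * V -> C) := forall b,
  `|complex.Re (m b)| <= M /\ eps <= complex.Im (m b) <= M.

Let dom_weak m : dom m -> weak m.
Proof.
move=> h b; have [h1 /andP[h2 h3]] := h b; split=> //.
by rewrite h3 (le_trans _ h2) // ltW.
Qed.

Let Im_ups m b : weak m -> eta <= complex.Im (ups m b) <= eta + N * M.
Proof.
move=> h; rewrite ImD Im_sum lerDl lerD2l; apply/andP; split.
  by apply: sumr_ge0 => u _; have [_ /andP[]] := h (b.2, u).
apply: (@le_trans _ _ (\sum_(u | e b.2 u && (u != b.1)) M)).
  by apply: ler_sum => u _; have [_ /andP[]] := h (b.2, u).
rewrite sumr_const -mulr_natl ler_pM2r // ler_nat; exact: max_card.
Qed.

Let Re_ups m b : weak m -> `|complex.Re (ups m b)| <= `|complex.Re z| + N * M.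
Proof.
move=> h; rewrite ReD Re_sum (le_trans (ler_normD _ _)) // lerD2l.
apply: (le_trans (ler_norm_sum _ _ _)).
apply: (@le_trans _ _ (\sum_(u | e b.2 u && (u != b.1)) M)).
  by apply: ler_sum => u _; have [] := h (b.2, u).
rewrite sumr_const -mulr_natl ler_pM2r // ler_nat; exact: max_card.
Qed.

Let nsq_ups m b : weak m -> eta ^+ 2 <= nsq (ups m b) <= K2.
Proof.
move=> h; have /andP[h1 h2] := Im_ups b h; have h3 := Re_ups b h.
apply/andP; split.
  apply: le_trans (Im_sqr_le _); rewrite ler_pXn2r ?nnegrE ?(ltW z_gt0) //.
  exact: le_trans (ltW z_gt0) h1.
apply: lerD.
  by rewrite -[X in X <= _]real_normK ?num_real // ler_pXn2r ?nnegrE ?addr_ge0.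
rewrite ler_pXn2r ?nnegrE ?addr_ge0 ?(ltW z_gt0) //.
exact: le_trans (ltW z_gt0) h1.
Qed.

Let ups_neq0 m b : weak m -> ups m b != 0.
Proof.
move=> h; apply: Im_neq0; have /andP[h1 _] := Im_ups b h.
by rewrite gt_eqF // (lt_le_trans z_gt0).
Qed.

Let Im_step m b : complex.Im (step m b) = complex.Im (ups m b) / nsq (ups m b).
Proof. by rewrite ImN ImV mulNr opprK. Qed.

Let step_dom m : weak m -> dom (step m).
Proof.
move=> h b; have /andP[h1 h2] := nsq_ups b h; have /andP[h3 h4] := Im_ups b h.
have n_gt0 : 0 < nsq (ups m b) by apply: lt_le_trans h1; rewrite exprn_gt0.
have hn : nsq (step m b) <= M ^+ 2.
  by rewrite nsqN nsqV exprVn lef_pV2 ?posrE // exprn_gt0.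
split; first by apply: norm_le_of_sqr (le_trans (Re_sqr_le _) hn); exact: ltW.
apply/andP; split; last first.
  by apply: ler_of_sqr (le_trans (Im_sqr_le _) hn); exact: ltW.
rewrite Im_step ler_pM ?invr_ge0 ?(ltW z_gt0) ?(ltW K2_gt0) //.
by rewrite lef_pV2.
Qed.

(** If [s] is the imaginary part of the sum in [ups], then [s / (s + eta)] increases with [s], and
    [s <= N * M]. Hence [s] is at most [kap] times the imaginary part of [ups]. *)
Let kap : R := N * M / (N * M + eta).

Let kap_bounds : 0 <= kap < 1.
Proof.
have p : 0 < N * M + eta by rewrite ltr_wpDl.
by rewrite divr_ge0 ?(ltW p) //= ltr_pdivrMr // mul1r ltrDl.
Qed.

(* For [a], [b] in the upper half plane, [|a - b|^2 / (Im a * Im b)] is an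
   increasing function of their hyperbolic distance. *)
Let step_contract m m' t : dom m -> dom m' -> 0 <= t ->
  (forall b, nsq (m b - m' b) <= t * (complex.Im (m b) * complex.Im (m' b))) ->
  forall b, nsq (step m b - step m' b) <=
    kap ^+ 2 * t * (complex.Im (step m b) * complex.Im (step m' b)).
Proof.
move=> hm hm' t0 h b.
have wm := dom_weak hm; have wm' := dom_weak hm'.
have n0 := ups_neq0 b wm; have n0' := ups_neq0 b wm'.
(* The map [a -> - a^-1] is a hyperbolic isometry: the factors [nsq (ups _ b)] cancel, and the gain
   comes only from the translation by [z]. *)
have -> : step m b - step m' b = (ups m b - ups m' b) * (ups m b * ups m' b)^-1.
  by rewrite /step; field; rewrite n0 n0'.
rewrite nsqM nsqV nsqM !Im_step.
have p : 0 < nsq (ups m b) by rewrite lt_def nsq_eq0 n0 nsq_ge0.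
have p' : 0 < nsq (ups m' b) by rewrite lt_def nsq_eq0 n0' nsq_ge0.
rewrite mulf_div mulrA ler_pM2r ?invr_gt0 ?mulr_gt0 //.
have -> : ups m b - ups m' b =
    \sum_(u | e b.2 u && (u != b.1)) (m (b.2, u) - m' (b.2, u)).
  by rewrite /ups opprD addrACA subrr add0r sumrB.
have I0 x : dom x -> forall c, 0 <= complex.Im (x c).
  by move=> hx c; have [_ /andP[]] := dom_weak hx c.
apply: le_trans (nsq_sum_weighted _ _ t0 (fun=> I0 _ hm _) (fun=> I0 _ hm' _)
  (fun u => h (b.2, u))) _.
have -> : kap ^+ 2 * t * (complex.Im (ups m b) * complex.Im (ups m' b)) =
    t * (kap * complex.Im (ups m b) * (kap * complex.Im (ups m' b))) by ring.
rewrite ler_wpM2l //.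
have key x : weak x -> \sum_(u | e b.2 u && (u != b.1)) complex.Im (x (b.2, u))
    <= kap * complex.Im (ups x b).
  move=> hx; have /andP[_] := Im_ups b hx; rewrite ImD Im_sum lerD2l.
  set s := \sum_(_ | _) _ => sNM.
  have q : 0 < N * M + eta by rewrite ltr_wpDl.
  rewrite /kap mulrAC ler_pdivlMr // !mulrDr.
  by have := ler_wpM2r (ltW z_gt0) sNM; lra.
have s0 x : dom x -> 0 <= \sum_(u | e b.2 u && (u != b.1)) complex.Im (x (b.2, u)).
  by move=> hx; apply: sumr_ge0 => u _; exact: I0.
exact: ler_pM (s0 _ hm) (s0 _ hm') (key _ wm) (key _ wm').
Qed.

(** The iteration is shifted by one so that the first term is already in [dom]. *)
Let seqm (n : nat) : V * V -> C := iter n.+1 step (fun=> 0).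

Let seqm_dom n : dom (seqm n).
Proof.
elim: n => [|n IH]; last exact/step_dom/dom_weak.
by apply: step_dom => b /=; rewrite normr0 lexx (ltW M_gt0).
Qed.

(** Chosen for the start of the induction: [(T * eps) ^+ 2 = 9 * M ^+ 2], which exceeds the bound
    [5 * M ^+ 2] of [nsqB_le]. *)
Let T : R := 3 * M / eps.

Let T_ge0 : 0 <= T.
Proof. by apply: divr_ge0; [apply: mulr_ge0|]; rewrite ?ler0n ?ltW. Qed.

Let seqm_close n b : nsq (seqm n.+1 b - seqm n b) <=
  (T * kap ^+ n) ^+ 2 * (complex.Im (seqm n.+1 b) * complex.Im (seqm n b)).
Proof.
elim: n b => [|n IH] b.
  rewrite expr0 mulr1.
  have [h1 /andP[h2 h3]] := seqm_dom 1 b.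
  have [k1 /andP[k2 k3]] := seqm_dom 0 b.
  apply: (@le_trans _ _ (T ^+ 2 * (eps * eps))); last first.
    apply: ler_wpM2l; first exact: sqr_ge0.
    by apply: ler_pM => //; apply: ltW.
  have -> : T ^+ 2 * (eps * eps) = 9 * M ^+ 2.
    by rewrite /T; field; rewrite gt_eqF ?eps_gt0.
  apply: (@le_trans _ _ (5 * M ^+ 2)); last first.
    by rewrite ler_wpM2r ?sqr_ge0 // ler_nat.
  have [x1 x2] := dom_weak (seqm_dom 1) b.
  have [y1 y2] := dom_weak (seqm_dom 0) b.
  exact: nsqB_le (ltW M_gt0) x1 x2 y1 y2.
have := step_contract (seqm_dom n.+1) (seqm_dom n) (sqr_ge0 (T * kap ^+ n)) IH b.
have -> : T * kap ^+ n.+1 = kap * (T * kap ^+ n) by rewrite exprS mulrCA.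
by rewrite [(kap * _) ^+ 2]exprMn.
Qed.

Let seqm_small n b : nsq (seqm n.+1 b - seqm n b) <= (T * M * kap ^+ n) ^+ 2.
Proof.
apply: le_trans (seqm_close n b) _.
rewrite (mulrAC T) [X in _ <= X]exprMn ler_wpM2l ?sqr_ge0 //.
rewrite [X in _ <= X]expr2.
have [_ /andP[h2 h3]] := seqm_dom n.+1 b; have [_ /andP[k2 k3]] := seqm_dom n b.
by apply: ler_pM => //; apply: le_trans (ltW eps_gt0) _.
Qed.

Let seqm_cvg b : exists l, ccvg (fun n => seqm n b) l.
Proof.
have /andP[k0 k1] := kap_bounds.
have c0 : 0 <= T * M by rewrite mulr_ge0 // ltW.
have cr : cvgn (fun n => complex.Re (seqm n b)).
  apply: (cvg_geometric_increments c0 kap_bounds) => n.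
  apply: norm_le_of_sqr; first by rewrite mulr_ge0 ?exprn_ge0.
  by apply: le_trans (seqm_small n b); rewrite -ReN -ReD Re_sqr_le.
have ci : cvgn (fun n => complex.Im (seqm n b)).
  apply: (cvg_geometric_increments c0 kap_bounds) => n.
  apply: norm_le_of_sqr; first by rewrite mulr_ge0 ?exprn_ge0.
  by apply: le_trans (seqm_small n b); rewrite -ImN -ImD Im_sqr_le.
by exists (Complex (limn (fun n => complex.Re (seqm n b)))
               (limn (fun n => complex.Im (seqm n b)))).
Qed.

(** The bound [eps] survives in the limit and keeps the imaginary part positive. The recursion is
    passed to the limit in multiplied form, which needs no limit of inverses. *)
Lemma herglotz_fixed_point : exists m : V * V -> C,
  (forall b, 0 < complex.Im (m b)) /\
  forall w v, m (w, v) * (z + \sum_(u | e v u && (u != w)) m (v, u)) = -1.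
Proof.
have [m hm] := choice seqm_cvg; exists m; split=> [b|w v].
  apply: (lt_le_trans eps_gt0); have [_ ci] := hm b.
  apply: (cvgr_to_ge ci); apply: nearW => n.
  by have [_ /andP[]] := seqm_dom n b.
have hE n : seqm n.+1 (w, v) *
    (z + \sum_(u | e v u && (u != w)) seqm n (v, u)) = -1.
  rewrite -[LHS]/(step (seqm n) (w, v) * ups (seqm n) (w, v)) mulNr.
  by rewrite mulVf // ups_neq0 //; exact/dom_weak/seqm_dom.
apply: (@ccvg_unique _ (fun n => seqm n.+1 (w, v) *
    (z + \sum_(u | e v u && (u != w)) seqm n (v, u)))).
  apply: ccvgM; first exact: (@ccvgS _ (fun n => seqm n (w, v))).
  by apply: ccvgD; [apply: ccvg_cst | apply: ccvg_sum].
by under eq_fun do rewrite hE; apply: ccvg_cst.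
Qed.
End HerglotzFixedPoint.

(** [Z] is [- m] if [z] is in the upper half-plane; otherwise the fixed point for the conjugate of
    [z] is conjugated. The sign condition is stated as a product to cover both cases. *)
Lemma zeta_exists (R : realType) (V : finType) (e : rel V) (z : R[i]) :
  complex.Im z != 0 -> exists Z : V * V -> R[i],
  (forall b, complex.Im (Z b) * complex.Im z < 0) /\
  forall w v, Z (w, v) * (z - \sum_(u | e v u && (u != w)) Z (v, u)) = 1.
Proof.
move=> z0; have [z_lt0|z_gt0|/eqP] := ltgtP (complex.Im z) 0;
  last by rewrite (negPf z0).
  have cz_gt0 : 0 < complex.Im (conjc z) by case: (z) z_lt0 => a b /=;
    rewrite oppr_gt0.
  have [m [m_gt0 mE]] := herglotz_fixed_point e cz_gt0.
  exists (fun b => - conjc (m b)); split=> [b|w v].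
    rewrite nmulr_llt0 // ImN; have := m_gt0 b; case: (m b) => x y /=.
    by rewrite opprK.
  rewrite sumrN opprK mulNr -[1]opprK; congr (- _).
  by rewrite -[z]conjcK -rmorph_sum -rmorphD -rmorphM mE rmorphN1.
have [m [m_gt0 mE]] := herglotz_fixed_point e z_gt0.
exists (fun b => - m b); split=> [b|w v].
  by rewrite pmulr_llt0 // ImN oppr_lt0.
by rewrite sumrN opprK mulNr mE opprK.
Qed.

(** * Uniqueness of square-summable solutions *)

Section SquareSummable.
Variables (R : realType) (X : choiceType).
Local Open Scope classical_set_scope.
Local Notation C := R[i].
Implicit Types (f g : X -> C) (s : seq X).

(** Reduces square summability to bounds on finite lists, the form in which it is proved and used
    below. *)
Lemma ell2P f : ell2 f <->
  exists B, forall s, uniq s -> \sum_(x <- s) nsq (f x) <= B.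
Proof.
rewrite /ell2; under eq_esum do rewrite -nsqE; split=> [h|[B hB]].
  pose E := (\esum_(x in [set: X]) (nsq (f x))%:E)%E.
  have E_ge0 : (0 <= E)%E by apply: esum_ge0 => x _; rewrite lee_fin nsq_ge0.
  have E_fin : E \is a fin_num by rewrite ge0_fin_numE.
  exists (fine E) => s us; rewrite -lee_fin fineK // -sumEFin.
  apply: esum_ge; exists [set` s]; first by split=> //; exact: finite_seq.
  by rewrite fsbig_seq.
apply: (@le_lt_trans _ _ B%:E); last exact: ltry.
apply: ge_ereal_sup => _ [A [finA _] <-].
by rewrite fsbig_finite //= sumEFin lee_fin hB.
Qed.

Lemma nsqB_le2 (a b : C) : nsq (a - b) <= 2 * nsq a + 2 * nsq b.
Proof.
rewrite -subr_ge0; have -> : 2 * nsq a + 2 * nsq b - nsq (a - b) = nsq (a + b).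
  by rewrite /nsq !ReD !ImD !ReN !ImN; ring.
exact: nsq_ge0.
Qed.

Lemma ell2B f g : ell2 f -> ell2 g -> ell2 (fun x => f x - g x).
Proof.
move=> /ell2P[A hA] /ell2P[B hB]; apply/ell2P; exists (2 * A + 2 * B) => s us.
apply: (@le_trans _ _ (\sum_(x <- s) (2 * nsq (f x) + 2 * nsq (g x)))).
  by apply: ler_sum => x _; exact: nsqB_le2.
rewrite big_split /= -!mulr_sumr.
by apply: lerD; rewrite ler_pM2l //; [exact: hA | exact: hB].
Qed.

End SquareSummable.

Section ResolventUniqueness.
Variables (R : realType) (X : choiceType) (r : X -> X -> Prop).
Variables (N : X -> seq X) (D : nat) (z : R[i]).
Local Open Scope classical_set_scope.
Local Notation C := R[i].
Hypothesis NP : forall x y, r x y <-> y \in N x.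
Hypothesis N_uniq : forall x, uniq (N x).
Hypothesis N_sym : forall x y, (y \in N x) = (x \in N y).
Hypothesis N_size : forall x, (size (N x) <= D)%N.
Hypothesis z_neq0 : complex.Im z != 0.

Lemma adj_opE (f : X -> C) x : adj_op r f x = \sum_(y <- N x) f y.
Proof.
have rN : [set y | r x y] = [set` N x] by apply/seteqP; split=> y /= /NP.
by rewrite /adj_op rN -(fsbig_seq _ _ (N_uniq x)).
Qed.

(** This is the imaginary part of [conjc a * b], the current of [f] along an edge when [a] and [b]
    are its values at the ends. *)
Let wr (a b : C) : R :=
  complex.Re a * complex.Im b - complex.Im a * complex.Re b.

Let wr_anti a b : wr a b = - wr b a.
Proof. by rewrite /wr; ring. Qed.

(** A weighted arithmetic-geometric mean inequality. A small [k] makes the term in [a] negligible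
    against the left side of [energy]. *)
Let wr_le k a b : 0 <= k -> k * wr a b <= k ^+ 2 * nsq a + nsq b.
Proof.
move=> k0; rewrite -subr_ge0.
have -> : k ^+ 2 * nsq a + nsq b - k * wr a b = 2^-1 * (k ^+ 2 * nsq a + nsq b) +
   2^-1 * ((k * complex.Re a - complex.Im b) ^+ 2 +
           (k * complex.Im a + complex.Re b) ^+ 2) by rewrite /nsq /wr; field.
have h2 : (0 : R) <= 2^-1 by rewrite invr_ge0.
apply: addr_ge0; apply: (mulr_ge0 h2); apply: addr_ge0;
  rewrite ?sqr_ge0 ?nsq_ge0 //.
exact: mulr_ge0 (sqr_ge0 _) (nsq_ge0 _).
Qed.

Let wr_sum (a : C) (s : seq X) (f : X -> C) :
  \sum_(y <- s) wr a (f y) = wr a (\sum_(y <- s) f y).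
Proof. by rewrite /wr Re_sum Im_sum sumrB !mulr_sumr. Qed.

(** Each edge inside [s] occurs in both directions, with opposite currents. *)
Let wr_in (f : X -> C) (s : seq X) : uniq s ->
  \sum_(x <- s) \sum_(y <- N x | y \in s) wr (f x) (f y) = 0.
Proof.
move=> us; pose h (x y : X) : R := (y \in N x)%:R * wr (f x) (f y).
have -> : \sum_(x <- s) \sum_(y <- N x | y \in s) wr (f x) (f y) =
    \sum_(x <- s) \sum_(y <- s) h x y.
  apply: eq_bigr => x _; rewrite /h.
  under [RHS]eq_bigr do rewrite mulr_natl mulrb.
  rewrite -big_mkcond /= -big_filter -[RHS]big_filter; apply: perm_big.
  apply: uniq_perm; rewrite ?filter_uniq // => y.
  by rewrite !mem_filter andbC.
set a := LHS; suff : a = - a by move=> E; lra.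
rewrite {1}/a exchange_big /= /a -sumrN; apply: eq_bigr => x _.
by rewrite -sumrN; apply: eq_bigr => y _; rewrite /h N_sym wr_anti mulrN.
Qed.

(* Energy estimate on the finite set [s]: the flux out of [s] is controlled by
   the mass of [f] on the outer boundary [t] of [s]. *)
Let energy (f : X -> C) (s : seq X) (k : R) : uniq s -> 0 <= k ->
  (forall x, \sum_(y <- N x) f y = z * f x) ->
  exists t : seq X, [/\ uniq t, {in t, forall x, x \notin s} &
    k * `|complex.Im z| * \sum_(x <- s) nsq (f x) <=
    D%:R * (k ^+ 2 * \sum_(x <- s) nsq (f x) + \sum_(x <- t) nsq (f x))].
Proof.
move=> us k0 hf.
pose t := undup [seq y <- flatten [seq N x | x <- s] | y \notin s].
exists t; split; [exact: undup_uniq| |].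
  by move=> y; rewrite mem_undup mem_filter => /andP[].
have mem_t x y : x \in s -> y \in N x -> y \notin s -> y \in t.
  move=> xs yN ys; rewrite mem_undup mem_filter ys /=.
  by apply/flatten_mapP; exists x.
pose F : R := \sum_(x <- s) \sum_(y <- N x | y \notin s) wr (f x) (f y).
(* The edges inside [s] contribute nothing, so [F] may be summed over all of [N x], where the
   eigenvalue equation turns the inner sum into [wr (f x) (z * f x)]. *)
have FE : F = complex.Im z * \sum_(x <- s) nsq (f x).
  transitivity (\sum_(x <- s) \sum_(y <- N x | y \in s) wr (f x) (f y) + F).
    by rewrite wr_in ?add0r.
  rewrite /F -big_split [RHS]mulr_sumr; apply: eq_bigr => x _ /=.
  rewrite -(bigID (fun y => y \in s) xpredT) /=.
  by rewrite wr_sum hf /wr ReM ImM /nsq; ring.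
(* A bound for both signs bounds the absolute value; the sign is absorbed into [f y]. *)
have bound (sg : R) : sg ^+ 2 = 1 -> k * (sg * F) <=
    D%:R * (k ^+ 2 * \sum_(x <- s) nsq (f x) + \sum_(x <- t) nsq (f x)).
  move=> sg1.
  apply: (@le_trans _ _ (\sum_(x <- s) \sum_(y <- N x | y \notin s)
      (k ^+ 2 * nsq (f x) + nsq (f y)))).
    rewrite /F !mulr_sumr; apply: ler_sum => x _; rewrite !mulr_sumr.
        apply: ler_sum => y _; pose sgc : C := sg%:C.
    have -> : sg * wr (f x) (f y) = wr (f x) (sgc * f y).
      by rewrite /wr ReM ImM /=; ring.
    have -> : nsq (f y) = nsq (sgc * f y).
      by rewrite nsqM /nsq /= sg1 expr0n addr0 mul1r.
    exact: wr_le.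
  under eq_bigr do rewrite big_split /=.
    rewrite big_split mulrDr /=; apply: lerD.
    rewrite !mulr_sumr; apply: ler_sum => x _.
    rewrite big_const_seq iter_addr_0 -[_ *+ count _ _]mulr_natl ler_wpM2r //.
      by rewrite mulr_ge0 ?sqr_ge0 ?nsq_ge0.
    by rewrite ler_nat (leq_trans (count_size _ _)).
  (* Double counting: a vertex of [t] is counted once for each of its neighbours in [s], hence at
     most [D] times. *)
  pose h (x y : X) : R := (y \in N x)%:R * nsq (f y).
  apply: (@le_trans _ _ (\sum_(x <- s) \sum_(y <- t) h x y)).
    rewrite big_seq [X in _ <= X]big_seq; apply: ler_sum => x xs; rewrite /h.
    under [X in _ <= X]eq_bigr do rewrite mulr_natl mulrb.
    rewrite -[X in _ <= X]big_mkcond /= -big_filter -[X in _ <= X]big_filter.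
    rewrite (perm_big [seq y <- t | y \in N x]) //=.
    apply: uniq_perm; rewrite ?filter_uniq ?undup_uniq // => y.
    rewrite !mem_filter; apply/andP/andP => [[ys yN]|[yN yt]].
      by split=> //; exact: mem_t yN ys.
    by split=> //; move: yt; rewrite mem_undup mem_filter => /andP[].
  rewrite exchange_big mulr_sumr /=; apply: ler_sum => y _.
  rewrite /h -mulr_suml ler_wpM2r ?nsq_ge0 // -natr_sum ler_nat.
  have -> : (\sum_(x <- s) (y \in N x) = size [seq x <- s | y \in N x])%N.
    by rewrite size_filter -sum1_count [RHS]big_mkcond; apply: eq_bigr => x _;
      case: (_ \in _).

  apply: leq_trans (N_size y); apply: uniq_leq_size; first exact: filter_uniq.
  by move=> x; rewrite mem_filter N_sym => /andP[].
rewrite -mulrA; have -> : `|complex.Im z| * \sum_(x <- s) nsq (f x) = `|F|.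
  by rewrite FE normrM (ger0_norm (sumr_ge0 _ _)) // => x _; exact: nsq_ge0.
have [F0|F0] := ger0P F; first by rewrite -[F]mul1r bound ?expr1n.
by rewrite -mulN1r bound // sqrrN expr1n.
Qed.

(** A finite set [s'] carrying almost all of the l^2 mass has a boundary of mass at most [del]. The
    flux through that boundary is then too small for [energy]. *)
Lemma kernel_eq0 (f : X -> C) : ell2 f ->
  (forall x, \sum_(y <- N x) f y = z * f x) -> forall x, f x = 0.
Proof.
move=> /ell2P[B hB] hf x0; apply/eqP; apply: contraT => fx0.
pose q := nsq (f x0); pose m (s : seq X) := \sum_(x <- s) nsq (f x).
have q0 : 0 < q by rewrite lt_def nsq_eq0 fx0 nsq_ge0.
pose A : set R := [set m s | s in [set s | uniq s]].
have hA : has_sup A.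
  split; first by exists (m [::]); exists [::].
  by exists B => _ [s us <-]; exact: hB.
(* [d] replaces [D] so as to be positive. With [k] and [del] below, [d * k ^+ 2 = k * eta / 2] and
   [d * del = k * eta * q / 4], so [energy] gives [m s' <= q / 2], against [q <= m s']. *)
pose d : R := D%:R + 1.
have d0 : 0 < d by rewrite ltr_wpDl ?ler0n.
pose eta := `|complex.Im z|; have eta0 : 0 < eta by rewrite normr_gt0.
pose k := eta / (2 * d); have k0 : 0 < k by rewrite divr_gt0 // mulr_gt0.
pose del := k * eta * q / (4 * d).
have keq0 : 0 < k * eta * q by apply: mulr_gt0 => //; apply: mulr_gt0.
have del0 : 0 < del by apply: divr_gt0 => //; apply: mulr_gt0.
have [_ [s us <-] hs] := sup_adherent del0 hA.
(* Adjoining [x0] keeps the mass near the supremum and makes it at least [q]. *)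
have [s' [us' ms' qs']] : exists s', [/\ uniq s', m s <= m s' & q <= m s'].
  have [xs|xs] := boolP (x0 \in s).
    exists s; split=> //; rewrite /m (big_rem x0) //= lerDl.
    by apply: sumr_ge0 => x _; exact: nsq_ge0.
  exists (x0 :: s); split; rewrite /= ?xs // /m big_cons ?lerDr ?lerDl ?nsq_ge0 //.
  by apply: sumr_ge0 => x _; exact: nsq_ge0.
have [t [ut ts hE]] := energy us' (ltW k0) hf.
have mt : m t <= del.
  have : m (s' ++ t) <= sup A.
    apply: sup_upper_bound => //; exists (s' ++ t) => //=.
    rewrite cat_uniq us' ut andbT /=; apply/hasPn => x /ts //.
  by rewrite /m big_cat -/(m s') -/(m t) /=; lra.
move: hE; rewrite -/eta -/(m s') -/(m t) => hE.
have h1 : D%:R * (k ^+ 2 * m s' + m t) <= d * (k ^+ 2 * m s' + del).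
  have m_ge0 u : 0 <= m u by apply: sumr_ge0 => x _; exact: nsq_ge0.
  apply: ler_pM; [exact: ler0n| |by rewrite lerDl|by rewrite lerD2l].
  exact: addr_ge0 (mulr_ge0 (sqr_ge0 _) (m_ge0 _)) (m_ge0 _).
have h2 : d * (k ^+ 2 * m s' + del) = k * eta * m s' / 2 + k * eta * q / 4.
  by rewrite /del /k; field; rewrite gt_eqF.
have h3 : k * eta * q <= k * eta * m s' by rewrite ler_pM2l // mulr_gt0.

lra.
Qed.

Lemma resolvent_eq (f g : X -> C) : ell2 g ->
  (forall x, \sum_(y <- N x) g y - z * g x = f x) ->
  resolvent (adj_op r) z f = g.
Proof.
move=> g2 hg; rewrite /resolvent; apply: xget_unique.
  by split=> // x; rewrite adj_opE.
move=> h [h2 hh]; apply/funext => x; apply/eqP; rewrite -subr_eq0; apply/eqP.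
apply: (kernel_eq0 (f := fun x => h x - g x)) (ell2B h2 g2) _ x => x.
have := hh x; rewrite adj_opE -hg sumrB => E.
apply/eqP; rewrite -subr_eq0.
rewrite (_ : _ - _ = (\sum_(y <- N x) h y - z * h x) -
    (\sum_(y <- N x) g y - z * g x)); last by ring.
by rewrite E subrr.
Qed.

End ResolventUniqueness.

(** * Green functions of trees *)

Section TreeDistance.
Variables (X : choiceType) (r : rel X) (o : X).
Hypotheses (r_sym : symmetric r) (r_irr : irreflexive r).
Hypotheses (r_conn : connected_graph r) (r_acyc : acyclic_graph r).
Local Open Scope classical_set_scope.

(** The walk, shortened to a simple path, closes up through [x] into a cycle; it has more than two
    vertices because [y != y']. *)
Lemma neighbors_separated x y y' s : r x y -> r x y' -> y != y' ->
  path r y s -> last y s = y' -> x \notin y :: s -> False.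
Proof.
move=> xy xy' yy' ps ls; move: ls; have [s' ps' us' sub ls] := shortenP ps.
rewrite inE negb_or => /andP[nxy nxs].
have {}nxs : x \notin s' by apply: contra nxs => /sub.
have s'0 : (0 < size s')%N.
  by case: (s') ls yy' => //= ->; rewrite eqxx.
apply: (r_acyc (c := x :: y :: s')) => //.
rewrite /ucycle /= rcons_path ls [r y' x]r_sym xy xy' ps' /=.
by rewrite inE negb_or nxy nxs; exact: us'.
Qed.

Let walk_exists x : exists n,
  `[< exists s, [/\ path r o s, last o s = x & size s = n] >].
Proof. by have [s [ps ls]] := r_conn o x; exists (size s); apply/asboolP;
  exists s. Qed.

Definition gdist x := ex_minn (walk_exists x).

Lemma gdist_walk x : exists s, [/\ path r o s, last o s = x & size s = gdist x].
Proof. by rewrite /gdist; case: ex_minnP => n /asboolP. Qed.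

Lemma gdist_le s : path r o s -> (gdist (last o s) <= size s)%N.
Proof.
rewrite /gdist; case: ex_minnP => n _ h ps; apply: h.
by apply/asboolP; exists s.
Qed.

Lemma gdist_root : gdist o = 0%N.
Proof. by apply/eqP; rewrite -leqn0; exact: (@gdist_le [::]). Qed.

Lemma gdist0 x : gdist x = 0%N -> x = o.
Proof. by have [[|y s] [_ <- //= <-]] := gdist_walk x. Qed.

Lemma gdist_adj x y : r x y -> (gdist y <= (gdist x).+1)%N.
Proof.
move=> xy; have [s [ps ls <-]] := gdist_walk x.
rewrite -(size_rcons s y) -{1}(last_rcons o s y); apply: gdist_le.
by rewrite rcons_path ps ls.
Qed.

(** A shortest walk to [y] that met [x] would be strictly longer than [gdist x]. *)
Lemma gdist_walk_avoiding x y : (gdist y <= gdist x)%N -> y != x ->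
  exists s, [/\ path r o s, last o s = y & x \notin o :: s].
Proof.
move=> yx nyx; have [s [ps ls ss]] := gdist_walk y; exists s; split=> //.
apply/negP => xs; move: ps ls ss; case/splitPl: xs => s1 s2 ls1.
rewrite cat_path last_cat size_cat ls1 => /andP[/gdist_le]; rewrite ls1.
case: s2 => [|a s2] /= h _ E ss; first by rewrite E eqxx in nyx.
by move: (leq_trans h (leq_addr (size s2).+1 _)); lia.
Qed.

Lemma walk_rev s : path r o s ->
  path r (last o s) (rev (belast o s)) /\
  last (last o s) (rev (belast o s)) = o.
Proof.
move=> ps; split; last by case: s ps => //= a s _; rewrite rev_cons last_rcons.
by rewrite rev_path (eq_path (e' := r)) // => a b; rewrite r_sym.
Qed.

(** Otherwise going from [y] back to the root and on to [y'] avoids [x], against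
    [neighbors_separated]. Since the inequalities are not strict, this also excludes edges between
    vertices at equal distance. *)
Lemma parent_unique x y y' : r x y -> r x y' ->
  (gdist y <= gdist x)%N -> (gdist y' <= gdist x)%N -> y = y'.
Proof.
move=> xy xy' dy dy'; apply/eqP; apply: contraT => nyy'.
have nyx : y != x by apply: contraTneq xy => ->; rewrite r_irr.
have nyx' : y' != x by apply: contraTneq xy' => ->; rewrite r_irr.
have [s [ps ls xs]] := gdist_walk_avoiding dy nyx.
have [s' [ps' ls' xs']] := gdist_walk_avoiding dy' nyx'.
have [pr lr] := walk_rev ps; rewrite ls in pr lr.
exfalso; apply: (neighbors_separated (s := rev (belast o s) ++ s') xy xy' nyy').
- by rewrite cat_path pr lr.
- by rewrite last_cat lr.
- rewrite inE mem_cat mem_rev !negb_or eq_sym nyx /=.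
  move: xs'; rewrite inE negb_or => /andP[_ ->]; rewrite andbT.
  by apply: contra xs => /mem_belast.
Qed.

Lemma parent_exists x : x != o -> exists y, r x y /\ gdist x = (gdist y).+1.
Proof.
move=> xo; have [s [ps ls ss]] := gdist_walk x; case/lastP: s ps ls ss => [|s y].
  by move=> _ ls _; rewrite -ls eqxx in xo.
rewrite rcons_path last_rcons size_rcons => /andP[ps ry] yx; subst y => ss.
exists (last o s); split; first by rewrite r_sym.
apply/eqP; rewrite eqn_leq gdist_adj //= -ss ltnS; exact: gdist_le.
Qed.

Definition parent x := xget o [set y | r x y /\ gdist x = (gdist y).+1].

Lemma parentP x : x != o -> r x (parent x) /\ gdist x = (gdist (parent x)).+1.
Proof. by move=> xo; exact: (xgetPex o (parent_exists xo)). Qed.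

Lemma parent_child x y : r x y -> gdist y = (gdist x).+1 -> parent y = x.
Proof.
move=> xy dy; have yo : y != o.
  by apply: contra_eq_neq dy => ->; rewrite gdist_root.
have [ry dp] := parentP yo.
by apply: (parent_unique (x := y)) => //; rewrite 1?r_sym //; lia.
Qed.

Lemma adj_childVparent x y : r x y ->
  gdist y = (gdist x).+1 \/ x != o /\ y = parent x.
Proof.
move=> xy; have := gdist_adj xy; rewrite leq_eqVlt => /orP[/eqP|]; first by left.
rewrite ltnS => dyx; right; have xo : x != o.
  apply/eqP => xo; move: dyx; rewrite xo gdist_root leqn0 => /eqP/gdist0 yo.
  by move: xy; rewrite xo yo r_irr.
split=> //; have [rp dp] := parentP xo.
by apply: (parent_unique xy rp) => //; lia.
Qed.

Lemma child_neq_parent x q y : x != o -> parent x = q -> r x y ->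
  (gdist y == (gdist x).+1) = (y != q).
Proof.
move=> xo pq xy; have [rp dp] := parentP xo; rewrite pq in rp dp.
apply/eqP/idP => [dy|/eqP yq]; first by apply/eqP => yq; rewrite yq in dy; lia.
by have [|[_]] := adj_childVparent xy => //; rewrite pq.
Qed.

End TreeDistance.

(** [L] may have repetitions, so the levels of the tree need not be shown disjoint. *)
Lemma ler_sum_uniq_sub (R : realDomainType) (T : eqType) (s L : seq T) (f : T
  -> R) :
  (forall x, 0 <= f x) -> uniq s -> {subset s <= L} ->
  \sum_(x <- s) f x <= \sum_(x <- L) f x.
Proof.
move=> f0; elim: s L => [|x s IH] L us sL; first by rewrite big_nil sumr_ge0.
have xL : x \in L by apply: sL; rewrite mem_head.
move: us => /= /andP[xs us].
rewrite big_cons (big_rem x xL) lerD2l; apply: IH => // y ys.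
have : y \in L by apply: sL; rewrite inE ys orbT.
rewrite (perm_mem (perm_to_rem xL)) inE => /orP[/eqP yx|//].
by rewrite -yx ys in xs.
Qed.

(** * Products along paths and the resolvent equation *)

Section TreeGreen.
Variables (R : realType) (X : choiceType) (r : rel X) (o : X).
Hypotheses (r_sym : symmetric r) (r_irr : irreflexive r).
Hypotheses (r_conn : connected_graph r) (r_acyc : acyclic_graph r).
Variables (N : X -> seq X) (D : nat) (z : R[i]).
Hypothesis NP : forall x y, (y \in N x) = r x y.
Hypothesis N_uniq : forall x, uniq (N x).
Hypothesis N_size : forall x, (size (N x) <= D)%N.
Hypothesis z_neq0 : complex.Im z != 0.
Local Notation C := R[i].
Variable W : X -> X -> C.
Hypothesis W_Im : forall x y, complex.Im (W x y) * complex.Im z < 0.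
Hypothesis WE : forall q x, r q x ->
  W q x * (z - \sum_(u <- N x | u != q) W x u) = 1.

Local Notation d := (gdist o r_conn).
Local Notation par := (parent o r_conn).

(** The product of [W] along the path from [o] to [x], by recursion on the distance [n] from the
    root. *)
Fixpoint path_prod_rec n x : C :=
  if n is n'.+1 then W (par x) x * path_prod_rec n' (par x) else 1.

Definition path_prod x := path_prod_rec (d x) x.

Lemma path_prod_root : path_prod o = 1.
Proof. by rewrite /path_prod gdist_root. Qed.

Lemma path_prod_child x y : r x y -> d y = (d x).+1 ->
  path_prod y = W x y * path_prod x.
Proof.
by move=> xy dy; rewrite /path_prod dy /= (parent_child r_sym r_irr r_acyc xy dy).
Qed.

Let children x := [seq u <- N x | d u == (d x).+1].

Let level n := iter n (fun L => flatten [seq children x | x <- L]) [:: o].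

Let mem_level x : x \in level (d x).
Proof.
suff h n y : d y = n -> y \in level n by exact: h.
elim: n y => [|n IH] {}x dx; first by rewrite (gdist0 dx) mem_seq1.
have xo : x != o by apply: contra_eq_neq dx => ->; rewrite gdist_root.
have [rp dp] := parentP r_sym r_conn xo.
apply/flatten_mapP; exists (par x); first by apply: IH; lia.
by rewrite mem_filter NP r_sym rp dp eqxx.
Qed.

(** With this sign, [eta] and [w] are the absolute values of the imaginary parts of [z] and [W],
    whichever half-plane contains [z]. *)
Let sg := Num.sg (complex.Im z).
Let eta := complex.Im z * sg.
Let w x y : R := - complex.Im (W x y) * sg.

Let eta_gt0 : 0 < eta.
Proof. by rewrite /eta mulrC -normrEsg normr_gt0. Qed.

Let w_gt0 x y : 0 < w x y.
Proof.
have h := W_Im x y; rewrite /w mulNr oppr_gt0 /sg; move: h.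
have [z0|z0|z0] := ltgtP (complex.Im z) 0.
- by rewrite nmulr_llt0 // ltr0_sg // mulrN1 oppr_lt0.
- by rewrite pmulr_llt0 // gtr0_sg // mulr1.
- by have := z_neq0; rewrite z0 eqxx.
Qed.

(** The imaginary part of [W q x = A^-1], where [A] is the bracket in [WE]. *)
Let w_rec q x : r q x ->
  nsq (W q x) * (eta + \sum_(u <- N x | u != q) w x u) = w q x.
Proof.
move=> qx; pose A := z - \sum_(u <- N x | u != q) W x u.
have WA : W q x * A = 1 := WE qx.
have A0 : A != 0.
  by apply/eqP => A0; move/eqP: WA; rewrite A0 mulr0 eq_sym oner_eq0.
have WV : W q x = A^-1 by rewrite -[LHS](mulfK A0) WA mul1r.
rewrite /w WV ImV nsqV /A ImD ImN Im_sum.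
rewrite (_ : \sum_(u <- N x | u != q) - complex.Im (W x u) * sg =
   - (\sum_(u <- N x | u != q) complex.Im (W x u)) * sg); last first.
  by rewrite mulNr mulr_suml -sumrN; apply: eq_bigr => u _; rewrite mulNr.
by rewrite /eta; ring.
Qed.

(** The flux from [x] to its children. By [energy_child], the flux entering [u] splits into [eta]
    times the mass at [u] and the flux leaving [u]. *)
Let Q x := \sum_(u <- children x) nsq (path_prod x) * w x u.

Let energy_child x u : r x u -> d u = (d x).+1 ->
  eta * nsq (path_prod u) + Q u = nsq (path_prod x) * w x u.
Proof.
move=> xu du; rewrite /Q -mulr_sumr [eta * _]mulrC -mulrDr.
have uo : u != o by apply: contra_eq_neq du => ->; rewrite gdist_root.
have pu := parent_child r_sym r_irr r_acyc xu du.
rewrite -(w_rec xu) (path_prod_child xu du) nsqM [RHS]mulrCA [RHS]mulrA.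
congr (_ * (_ + _)); rewrite big_filter big_seq_cond [RHS]big_seq_cond.
apply: eq_bigl => v; case uv : (v \in N u) => //=; rewrite NP in uv.
exact: (child_neq_parent r_sym r_irr r_acyc).
Qed.

Let energy_level n : \sum_(x <- level n.+1) (eta * nsq (path_prod x) + Q x) =
  \sum_(x <- level n) Q x.
Proof.
rewrite /= big_flatten big_map; apply: eq_bigr => x _.
rewrite [LHS]big_seq [RHS]big_seq; apply: eq_bigr => u.
by rewrite mem_filter NP => /andP[/eqP du xu]; exact: energy_child.
Qed.

Let Q_ge0 x : 0 <= Q x.
Proof.
by apply: sumr_ge0 => u _; rewrite mulr_ge0 ?nsq_ge0 // ltW.
Qed.

Let energy_total n :
  eta * (\sum_(k < n.+1) \sum_(x <- level k) nsq (path_prod x)) +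
    \sum_(x <- level n) Q x = eta + Q o.
Proof.
elim: n => [|n IH].
  by rewrite big_ord1 /= !big_seq1 path_prod_root nsq1 mulr1.
rewrite -IH big_ord_recr /= mulrDr -addrA; congr (_ + _).
by rewrite -[RHS]energy_level [RHS]big_split /= mulr_sumr.
Qed.

(** By conservation of flux over the levels, [eta] times the mass of any finite number of levels is
    at most [eta + Q o]. *)
Lemma path_prod_ell2 : ell2 path_prod.
Proof.
apply/ell2P; exists ((eta + Q o) / eta) => s us.
pose n := \max_(x <- s) d x.
apply: (@le_trans _ _ (\sum_(x <- flatten [seq level k | k <- iota 0 n.+1])
    nsq (path_prod x))).
  apply: ler_sum_uniq_sub => [x||x xs] //; first exact: nsq_ge0.
  apply/flatten_mapP; exists (d x); last exact: mem_level.
  by rewrite mem_iota /= ltnS (leq_bigmax_seq _ xs).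
rewrite ler_pdivlMr // -(energy_total n) big_flatten big_map.
rewrite -(big_mkord xpredT (fun k => \sum_(x <- level k) nsq (path_prod x))).
rewrite /index_iota subn0 mulrC lerDl.
by apply: sumr_ge0.
Qed.

Section Restriction.
Variable B : pred X.
Hypothesis Bo : B o.
Hypothesis B_closed : forall x y, x != o -> B x -> r x y -> B y.

(** The diagonal Green function at the root. The whole tree and a branch rooted at [o] are both
    instances of [B]; only the root may lose neighbours. *)
Definition restr_root : C := (- z + \sum_(u <- N o | B u) W o u)^-1.
Definition restr_green x : C := if B x then restr_root * path_prod x else 0.
Let NB x := if B x then [seq u <- N x | B u] else [::].

(** The imaginary parts of [- z] and of every [W o u] have the same sign, so they cannot cancel. *)
Lemma restr_rootV : restr_root * (- z + \sum_(u <- N o | B u) W o u) = 1.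
Proof.
apply: mulVf; apply/eqP => /(congr1 (@complex.Im R)); rewrite ImD ImN Im_sum => E.
have h : 0 < eta + \sum_(u <- N o | B u) w o u.
  by rewrite ltr_wpDr // sumr_ge0 // => u _; exact: ltW.
move: h; rewrite (_ : _ + _ =
   - (- complex.Im z + \sum_(u <- N o | B u) complex.Im (W o u)) * sg).
  by rewrite E oppr0 mul0r ltxx.
rewrite /eta opprD opprK mulrDl mulNr mulr_suml -sumrN; congr (_ + _).
by apply: eq_bigr => u _; rewrite /w mulNr.
Qed.

Lemma restr_green_ell2 : ell2 restr_green.
Proof.
have /ell2P[K hK] := path_prod_ell2; apply/ell2P.
exists (nsq restr_root * K) => s us.
apply: (@le_trans _ _ (\sum_(x <- s) nsq restr_root * nsq (path_prod x))).
  apply: ler_sum => x _; rewrite /restr_green.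
  by case: (B x); rewrite ?nsqM // nsq0 mulr_ge0 ?nsq_ge0.
by rewrite -mulr_sumr ler_wpM2l ?nsq_ge0 ?hK.
Qed.

Lemma restr_green_eq x :
  \sum_(y <- NB x) restr_green y - z * restr_green x = delta R o x.
Proof.
rewrite /NB /delta /restr_green; case Bx : (B x); last first.
  rewrite big_nil mulr0 subr0; case: eqP => // xo.
  by move: Bx; rewrite xo Bo.
rewrite big_filter; under eq_bigr => u Bu do rewrite Bu.
have [xo|xo] := eqVneq x o.
  rewrite xo path_prod_root mulr1.
  rewrite (_ : \sum_(u <- N o | B u) restr_root * path_prod u =
    restr_root * \sum_(u <- N o | B u) W o u).
    by rewrite [z * _]mulrC -mulrBr addrC restr_rootV.
  rewrite mulr_sumr big_seq_cond [RHS]big_seq_cond.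
  apply: eq_bigr => u /andP[]; rewrite NP => ou _.
  have [du|[]] := adj_childVparent o r_sym r_irr r_conn r_acyc ou;
    last by rewrite eqxx.
  by rewrite (path_prod_child ou du) path_prod_root mulr1.
(* Away from the root [x] keeps all its neighbours: the parent [q] and the children. Factoring out
   [path_prod q] leaves the recursion [WE]. *)
have [rp dp] := parentP r_sym r_conn xo; set q := par x in rp dp.
rewrite -mulr_sumr mulrCA -mulrBr.
rewrite big_seq_cond (eq_bigl (fun u => u \in N x)); last first.
  by move=> u; rewrite NP; case xu: (r x u) => //=; rewrite (B_closed xo Bx xu).
rewrite -big_seq (bigD1_seq q) ?NP //=.
rewrite (_ : \sum_(u <- N x | u != q) path_prod u =
    (\sum_(u <- N x | u != q) W x u) * path_prod x); last first.
  rewrite mulr_suml big_seq_cond [RHS]big_seq_cond.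
  apply: eq_bigr => u /andP[]; rewrite NP => xu uq.
  apply: path_prod_child => //; apply/eqP.
  by rewrite (child_neq_parent r_sym r_irr r_acyc xo (erefl q) xu).
have rqx : r q x by rewrite r_sym.
rewrite (path_prod_child rqx dp).
rewrite (_ : _ - _ = path_prod q *
  (1 - W q x * (z - \sum_(u <- N x | u != q) W x u))); last by ring.
by rewrite (WE rqx) subrr !mulr0.
Qed.

Lemma restr_green_resolvent :
  resolvent (adj_op (fun x y => [/\ B x, B y & r x y])) z (delta R o) = restr_green.
Proof.
apply: (@resolvent_eq _ _ _ NB D) => //.
- move=> x y; rewrite /NB; case: (B x); last by split=> // -[].
  by rewrite mem_filter NP; split=> [[_ -> ->]|/andP[]].
- by move=> x; rewrite /NB; case: (B x); rewrite ?filter_uniq.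
- move=> x y; rewrite /NB; case Bx : (B x); case By : (B y) => //;
    by rewrite !mem_filter ?Bx ?By // !NP r_sym.
- move=> x; rewrite /NB; case: (B x) => //.
  by rewrite (leq_trans _ (N_size x)) // size_filter count_size.
- exact: restr_green_ell2.
- exact: restr_green_eq.
Qed.

End Restriction.
End TreeGreen.

(** * The determinant identity *)

Section FinMatrix.
Variable F : fieldType.

Definition fun_mx (K1 K2 : finType) (f : K1 -> K2 -> F) : 'M[F]_(#|K1|, #|K2|) :=
  \matrix_(i, j) f (enum_val i) (enum_val j).

Lemma fun_mx_eq (K1 K2 : finType) (f g : K1 -> K2 -> F) :
  (forall a b, f a b = g a b) -> fun_mx f = fun_mx g.
Proof. by move=> fg; apply/matrixP=> i j; rewrite !mxE fg. Qed.

Lemma fun_mxM (K1 K2 K3 : finType) (f : K1 -> K2 -> F) (g : K2 -> K3 -> F) :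
  fun_mx f *m fun_mx g = fun_mx (fun a c => \sum_b f a b * g b c).
Proof.
apply/matrixP=> i j; rewrite !mxE [RHS](reindex_onto enum_val enum_rank).
  by apply: eq_big => [k|k _]; rewrite ?enum_valK ?eqxx ?mxE.
by move=> k _; rewrite enum_rankK.
Qed.

Lemma fun_mxD (K1 K2 : finType) (f g : K1 -> K2 -> F) :
  fun_mx f + fun_mx g = fun_mx (fun a b => f a b + g a b).
Proof. by apply/matrixP=> i j; rewrite !mxE. Qed.

Lemma fun_mxB (K1 K2 : finType) (f g : K1 -> K2 -> F) :
  fun_mx f - fun_mx g = fun_mx (fun a b => f a b - g a b).
Proof. by apply/matrixP=> i j; rewrite !mxE. Qed.

Lemma fun_mx1 (K : finType) :
  fun_mx (fun a b : K => (a == b)%:R) = 1%:M.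
Proof. by apply/matrixP=> i j; rewrite !mxE (inj_eq enum_val_inj). Qed.

Lemma det_fun_mx_diag (K : finType) (d : K -> F) :
  \det (fun_mx (fun a b => (a == b)%:R * d a)) = \prod_a d a.
Proof.
have -> : fun_mx (fun a b => (a == b)%:R * d a) =
    diag_mx (\row_i d (enum_val i)).
  apply/matrixP=> i j; rewrite !mxE (inj_eq enum_val_inj).
  by rewrite mulr_natl.
rewrite det_diag [RHS](reindex_onto enum_val enum_rank).
  by apply: eq_big => [k|k _]; rewrite ?enum_valK ?eqxx ?mxE.
by move=> k _; rewrite enum_rankK.
Qed.

Lemma sum_eq_mul (K : finType) (a : K) (f : K -> F) :
  \sum_b (a == b)%:R * f b = f a.
Proof.
rewrite (bigD1 a) //= eqxx mul1r big1 ?addr0 // => b.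
by rewrite eq_sym => /negPf ->; rewrite mul0r.
Qed.

(** One block matrix is factored into triangular blocks in two ways. *)
Lemma det_1subM_comm m n (A : 'M[F]_(m, n)) (B : 'M[F]_(n, m)) :
  \det (1%:M - A *m B) = \det (1%:M - B *m A).
Proof.
pose M := block_mx 1%:M A B 1%:M.
have MU : M = block_mx 1%:M 0 B 1%:M *m block_mx 1%:M A 0 (1%:M - B *m A).
  rewrite mulmx_block ?(mul1mx, mul0mx, mulmx1, mulmx0, addr0, add0r).
  by rewrite addrC subrK.
have ML : M = block_mx (1%:M - A *m B) A 0 1%:M *m block_mx 1%:M 0 B 1%:M.
  by rewrite mulmx_block ?(mul1mx, mul0mx, mulmx1, mulmx0, addr0, add0r) subrK.
have := congr1 determinant ML; rewrite MU !det_mulmx det_lblock !det_ublock.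
by rewrite !det1 !mul1r !mulr1 => ->.
Qed.

(** Sylvester's identity exchanges the factors of [P *m N], and [N *m P] vanishes. *)
Lemma det_1add_nilpotent n (P N : 'M[F]_n) :
  P *m N = N -> N *m P = 0 -> \det (1%:M + N) = 1.
Proof.
move=> PN NP; rewrite -[N]opprK -{1}PN -mulmxN det_1subM_comm.
by rewrite mulNmx NP oppr0 subr0 det1.
Qed.

End FinMatrix.

(** * The determinant formula for arc weights *)

Section IharaBass.
Variables (R : realType) (V : finType) (e : rel V).
Hypotheses (e_sym : symmetric e) (e_irr : irreflexive e).
Local Notation C := R[i].
Local Notation K := (oriented_edge e).
Variables (z : C) (Z : V * V -> C) (S : V -> C) (g : {set V} -> C).
Hypothesis S_neq0 : forall v, S v != 0.
Hypothesis SE : forall v, S v = z - \sum_(u | e v u) Z (v, u).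
Hypothesis ZE : forall w v, e w v -> Z (w, v) * (S v + Z (v, w)) = 1.
Hypothesis gE : forall w v, e w v -> g [set w; v]%SET = Z (w, v) / S w.

Lemma rev_arc_proof (a : K) : e (val a).2 (val a).1.
Proof. by rewrite e_sym; case: a. Qed.

Definition rev_arc (a : K) : K :=
  exist (fun b : V * V => e b.1 b.2) ((val a).2, (val a).1) (rev_arc_proof a).

Lemma rev_arcK : involutive rev_arc.
Proof. by move=> a; apply: val_inj => /=; case: (val a). Qed.

(** Selects one orientation of each edge, which orders the two arcs of each 2 x 2 block. *)
Definition pos_arc (a : K) := (enum_rank (val a).1 < enum_rank (val a).2)%N.

Lemma pos_rev_arc a : pos_arc (rev_arc a) = ~~ pos_arc a.
Proof.
rewrite /pos_arc /= -leqNgt [RHS]leq_eqVlt.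
case: eqP => //= /ord_inj/enum_rank_inj E.
by have := valP a; rewrite /= E e_irr.
Qed.

Let zt (a : K) : C := Z (val a).

Let ztE a : zt a * (S (val a).2 + zt (rev_arc a)) = 1.
Proof. by have := ZE (valP a); rewrite /zt /= -surjective_pairing. Qed.

Let zt_neq0 a : zt a != 0.
Proof.
apply/eqP=> z0; have := ztE a; rewrite z0 mul0r => /eqP.
by rewrite eq_sym oner_eq0.
Qed.

Let zt_inv a : (zt a)^-1 = S (val a).2 + zt (rev_arc a).
Proof. by rewrite -[RHS](mulKf (zt_neq0 a)) ztE mulr1. Qed.

(** The difference of [ztE] for [a] and for [rev_arc a], in which the product of the two weights
    cancels. *)
Let ztS a : zt a * S (val a).2 = zt (rev_arc a) * S (val a).1.
Proof.
have := ztE a; have := ztE (rev_arc a); rewrite rev_arcK /= => h1 h2.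
have E := etrans h1 (esym h2); move/eqP: E; rewrite -subr_eq0.
set x := zt a in h1 h2 *; set y := zt _ in h1 h2 * => /eqP E.
by apply/eqP; rewrite -subr_eq0 -oppr_eq0; apply/eqP; rewrite -[RHS]E; ring.
Qed.

Lemma leadstoE (b a : K) :
  (leadsto b a)%:R = ((val b).2 == (val a).1)%:R - (b == rev_arc a)%:R :> C.
Proof.
rewrite /leadsto; case: b a => [[b1 b2] /= Hb] [[a1 a2] /= Ha].
rewrite -(inj_eq val_inj) /= !xpair_eqE.
case: (b2 =P a1) => [->|_]; last by rewrite andbF subr0.
by rewrite eqxx andbT /= eq_sym; case: (b1 == a2); rewrite ?subrr ?subr0.
Qed.

(* [zeta^-1 + J], where [J] reverses arcs. It is block diagonal, with one
   2 x 2 block per edge. *)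
Let Mf (a b : K) : C := (a == b)%:R * (zt a)^-1 + (rev_arc a == b)%:R.
(** [Sf] and [Tf] are the matrices of the operators [U] and [T] of the introduction. *)
Let Sf (a : K) (v : V) : C := ((val a).1 == v)%:R.
Let Tf (v : V) (b : K) : C := ((val b).2 == v)%:R.
(** [(zeta^-1 + J)^-1 U], read off the inverse of a 2 x 2 block: by [ztE],
    [zt a / (1 - zt a * zt (rev_arc a))] is [1 / S (val a).2]. *)
Let Wf (a : K) (v : V) : C :=
  (((val a).1 == v)%:R - zt (rev_arc a) * ((val a).2 == v)%:R) / S (val a).2.

Let M_W : fun_mx Mf *m fun_mx Wf = fun_mx Sf.
Proof.
rewrite fun_mxM; apply: fun_mx_eq => a v.
under eq_bigr do rewrite mulrDl -mulrA.
rewrite big_split /= sum_eq_mul (sum_eq_mul (rev_arc a)) /Wf /Sf /= rev_arcK.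
have h := ztS a; have h1 := ztE a.
have := S_neq0 (val a).1; have := S_neq0 (val a).2; have := zt_neq0 a.
set s1 := S (val a).1 in h h1 *; set s2 := S (val a).2 in h h1 *.
set x := zt a in h h1 *; set y := zt (rev_arc a) in h h1 *.
set p := _%:R; set q := _%:R => nx ns2 ns1.
(* Once [y] is eliminated, [ztE] becomes the relation [e2], and the difference of the two sides is a
   multiple of it. *)
have -> : y = x * s2 / s1 by rewrite h mulfK.
have e1 : x * s2 * (s1 + x) = s1.
  have -> : x * s2 * (s1 + x) = s1 * (x * s2) + x * (x * s2) by ring.
  by rewrite {2}h -[RHS]mulr1 -[in RHS]h1; ring.
have e2 : s1 * (1 - x * s2) = x * x * s2 by rewrite mulrBr mulr1 -{1}e1; ring.
apply/eqP; rewrite -subr_eq0; apply/eqP.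
transitivity (p * (s1 * (1 - x * s2) - x * x * s2) / (x * s2 * s1)).
  by field; rewrite nx ns1 ns2.
by rewrite e2 subrr mulr0 mul0r.
Qed.

(** Gaussian elimination in each block, positive arc first. For a negative arc [a] the second pivot
    is [(zt a)^-1 - zt (rev_arc a)], which is [S (val a).2] by [zt_inv]. *)
Let Lf (a b : K) : C := (~~ pos_arc a)%:R * ((rev_arc a == b)%:R * zt b).
Let Uf (a b : K) : C := (pos_arc a)%:R * ((rev_arc a == b)%:R * zt a).
Let Df (a : K) : C :=
  if pos_arc a then (zt a)^-1 else S (val a).2.

(** [Lf] has its rows on negative arcs and its columns on positive ones, so the projection onto
    negative arcs fixes it on the left and kills it on the right. *)
Let det_L : \det (1%:M + fun_mx Lf) = 1.
Proof.
apply: (@det_1add_nilpotent _ _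
  (fun_mx (fun a b => (a == b)%:R * (~~ pos_arc b)%:R))).
  rewrite fun_mxM; apply: fun_mx_eq => a b.
  under eq_bigr do rewrite -mulrA.
  by rewrite sum_eq_mul /Lf; case: (pos_arc a); rewrite /= ?mul0r ?mul1r.
rewrite fun_mxM; apply/matrixP=> i j; rewrite !mxE big1 // => b _.
rewrite /Lf; case: (b =P enum_val j) => [->|_]; last by rewrite mul0r mulr0.
case: eqP => [<-|_]; last by rewrite mul0r mulr0 mul0r.
by rewrite pos_rev_arc negbK; case: pos_arc; rewrite !(mulr0, mul0r).
Qed.

Let det_U : \det (1%:M + fun_mx Uf) = 1.
Proof.
apply: (@det_1add_nilpotent _ _
  (fun_mx (fun a b => (a == b)%:R * (pos_arc b)%:R))).
  rewrite fun_mxM; apply: fun_mx_eq => a b.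
  under eq_bigr do rewrite -mulrA.
  by rewrite sum_eq_mul /Uf; case: (pos_arc a); rewrite /= ?mul0r ?mul1r.
rewrite fun_mxM; apply/matrixP=> i j; rewrite !mxE big1 // => b _.
rewrite /Uf; case: (b =P enum_val j) => [->|_]; last by rewrite mul0r mulr0.
case: eqP => [<-|_]; last by rewrite mul0r mulr0 mul0r.
by rewrite pos_rev_arc; case: pos_arc; rewrite !(mulr0, mul0r).
Qed.

Let M_LDU : fun_mx Mf = (1%:M + fun_mx Lf) *m
  fun_mx (fun a b => (a == b)%:R * Df a) *m (1%:M + fun_mx Uf).
Proof.
rewrite -fun_mx1 !fun_mxD !fun_mxM; apply: fun_mx_eq => a c.
transitivity (\sum_b (((a == b)%:R + Lf a b) * Df b) *
   ((b == c)%:R + Uf b c)); last first.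
  apply: eq_bigr => b _; congr (_ * _); symmetry.
  under eq_bigr do rewrite mulrCA eq_sym.
  rewrite (bigD1 b) //= eqxx mul1r big1 ?addr0 // => d.
  by rewrite eq_sym => /negPf ->; rewrite mul0r.
under eq_bigr do rewrite !mulrDl -!mulrA.
rewrite big_split /= sum_eq_mul.
rewrite -mulr_sumr (sum_eq_mul (rev_arc a)) /Uf pos_rev_arc rev_arcK /Df
  pos_rev_arc /Mf.
have n1 := zt_neq0 a; have n2 := zt_neq0 (rev_arc a).
case pa : (pos_arc a) => /=; rewrite ?mul0r ?mul1r ?addr0.
  rewrite mulrDr [(_ == _)%:R * zt a]mulrC mulKf // ?(mulrC (zt a)^-1) //.
by rewrite mulVKf // zt_inv; ring.
Qed.

Lemma edgesE : edges e =
  [set [set (val a).1; (val a).2]%SET | a in [set a : K | pos_arc a]%SET]%SET.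
Proof.
apply/setP=> E; apply/imsetP/imsetP => [[b]|[a]]; last first.
  move=> _ ->; exists (val a) => //; rewrite inE; exact: (valP a).
rewrite inE => eb ->; pose a : K := exist (fun b : V * V => e b.1 b.2) b eb.
case pa : (pos_arc a); first by exists a; rewrite ?inE.
exists (rev_arc a); first by rewrite inE pos_rev_arc pa.
by rewrite /= finset.setUC.
Qed.

Lemma pos_arc_inj :
  {in [set a : K | pos_arc a]%SET &, injective
    (fun a : K => [set (val a).1; (val a).2]%SET)}.
Proof.
move=> a b; rewrite !inE => pa pb E.
have a1 : (val a).1 \in [set (val b).1; (val b).2]%SET by rewrite -E !inE eqxx.
have a2 : (val a).2 \in [set (val b).1; (val b).2]%SET
  by rewrite -E !inE eqxx orbT.
move: pa pb a1 a2; have := valP a; have := valP b; rewrite /pos_arc !inE /=.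
move=> _ ea pa pb /orP[] /eqP E1 /orP[] /eqP E2.
- by move: ea; rewrite E1 E2 e_irr.
- by apply: val_inj; rewrite /= [LHS]surjective_pairing E1 E2 -surjective_pairing.
- by move: pa; rewrite E1 E2 => /(ltn_trans pb); rewrite ltnn.
- by move: ea; rewrite E1 E2 e_irr.
Qed.

(** The pivots at a positive arc [a] and at its reverse multiply to [S (val a).1 / zt a], the
    inverse of [g] at that edge. *)
Let prod_gD : (\prod_(E in edges e) g E) * \prod_a Df a = 1.
Proof.
rewrite edgesE big_imset /=; last exact: pos_arc_inj.
under eq_bigl do rewrite inE.
rewrite (bigID pos_arc (fun=> true)) /=.
rewrite [X in _ * (_ * X)](reindex_inj (inv_inj rev_arcK)) /=.
under [X in _ * (_ * X)]eq_bigl do rewrite pos_rev_arc negbK.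
rewrite -!big_split /= big1 // => a pa.
rewrite gE; last exact: (valP a).
rewrite /Df pos_rev_arc pa /= -surjective_pairing -/(zt a).
have n0 := zt_neq0 a; have ns := S_neq0 (val a).1.
by field; rewrite n0 ns.
Qed.

Lemma ihara_bass :
  (\prod_(E in edges e) g E) *
    det_op (fun (f : K -> C) b => (Z (val b))^-1 * f b - nonbacktracking_op f b) =
  det_op (fun (f : V -> C) x => z * f x - vertex_op e f x) *
    \prod_(x : V) (S x)^-1.
Proof.
have -> : det_op (fun (f : K -> C) b =>
    (Z (val b))^-1 * f b - nonbacktracking_op f b) =
    \det (fun_mx Mf - fun_mx Sf *m fun_mx Tf).
  congr (\det _); rewrite fun_mxM fun_mxB; apply/matrixP=> i j; rewrite !mxE.
  set a := enum_val i; set b := enum_val j.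
  rewrite (sum_eq_mul (val a).1 (fun v => Tf v b)) /Mf /Tf -/(zt a) /delta.
  rewrite mulrC; have -> : nonbacktracking_op (delta R b) a = (leadsto b a)%:R.
    rewrite /nonbacktracking_op /delta big_mkcond (bigD1 b) //= eqxx big1.
      by rewrite addr0; case: leadsto.
    by move=> c /negPf ->; case: ifP.
  by rewrite leadstoE [rev_arc a == b]eq_sym; ring.
have -> : det_op (fun (f : V -> C) x => z * f x - vertex_op e f x) *
    \prod_(x : V) (S x)^-1 = \det (1%:M - fun_mx Tf *m fun_mx Wf).
  rewrite mulrC -det_fun_mx_diag -det_mulmx; congr (\det _).
  rewrite -fun_mx1 fun_mxM fun_mxB.
  apply/matrixP=> i j; rewrite !mxE.
  set v := enum_val i; set x := enum_val j.
  under eq_bigr do rewrite mxE -mulrA (inj_eq enum_val_inj) -/x.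
  rewrite (sum_eq_mul i (fun k => _ k * _)) -/v.
  (* The arcs ending at [v] are indexed by their origin [w]; the reverse of such an arc has weight
     [Z (v, w)]. *)
  rewrite (_ : \sum_b _ = \sum_(w | e v w) ((w == x)%:R - Z (v, w) * (v ==
    x)%:R) / S v).
    rewrite -mulr_suml big_split /= sumrN -mulr_suml /delta /vertex_op.
    have -> : \sum_(w | e v w) Z (v, w) = z - S v by rewrite SE; ring.
    have n := S_neq0 v; rewrite mxE -/v -/x.
    by field.
  rewrite /Tf /Wf; under eq_bigr do rewrite mulrC.
  pose h (w : V) (v' : V) : C := (((w == x)%:R - Z (v', w) * (v' == x)%:R) / S
    v') * (v' == v)%:R.
  transitivity (\sum_(a : K) h (val a).1 (val a).2).
    by apply: eq_bigr => a _; rewrite /h /zt /=.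
  transitivity (\sum_(b : V * V | e b.1 b.2) h b.1 b.2).
    rewrite [RHS](reindex_omap (val : K -> V * V) insub); last first.
      by move=> b eb; rewrite insubT.
    apply: eq_bigl => a; rewrite valK eqxx andbT; symmetry; exact: (valP a).
  rewrite -(pair_big_dep xpredT e (fun w v => h w v)) /= (exchange_big_dep
    xpredT) //=.
  rewrite (bigD1 v) //= [X in _ + X]big1 ?addr0.
    apply: eq_big => [w|w _]; first exact: e_sym.
    by rewrite /h eqxx mulr1.
  by move=> u /negPf nu; apply: big1 => w _; rewrite /h nu mulr0.
(* [M - U T = M (1 - W T)] since [U = M W]; Sylvester's identity then moves the second factor to the
   vertices. *)
rewrite -M_W -mulmxA -[X in X - _]mulmx1 -mulmxBr det_mulmx mulrA.
rewrite det_1subM_comm M_LDU !det_mulmx det_L det_U mul1r mulr1.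
by rewrite det_fun_mx_diag prod_gD mul1r.
Qed.

End IharaBass.

(** * Descent to the finite graph *)

(** A simple path from [y] to [x] off the deleted edge would close up with that edge into a cycle; a
    path of one step would be the deleted edge itself. *)
Lemma branch_far_notin (X : choiceType) (r : rel X) (y x : X) :
  symmetric r -> irreflexive r -> acyclic_graph r -> r x y -> ~ branch r y x x.
Proof.
move=> r_sym r_irr r_acyc xy [s [ps ls]]; move: ls.
have [s' ps' us' _ ls] := shortenP ps.
have nyx : y != x by apply: contraTneq xy => ->; rewrite r_irr.
apply: (r_acyc (y :: s')); last first.
  rewrite /ucycle us' andbT /= rcons_path ls xy andbT.
  by apply: sub_path ps' => a b /andP[/andP[]].
case: s' ps' ls {us'} => [_ /= yx|a [|b s']] //=; first by rewrite yx eqxx in nyx.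
by move=> + ax; rewrite ax /del_edge eqxx andbF.
Qed.

(** * The Green functions of the cover in terms of [Z] *)

Section UniversalCover.
Variables (R : realType) (V : finType) (e : rel V).
Variables (X : choiceType) (r : rel X) (p : X -> V) (z : R[i]).
Hypothesis e_simple : simple_graph e.
Hypothesis cover : universal_cover r e p.
Hypothesis z_neq0 : complex.Im z != 0.
Local Open Scope classical_set_scope.
Local Notation C := R[i].
Variable Z : V * V -> C.
Hypothesis Z_Im : forall b, complex.Im (Z b) * complex.Im z < 0.
Hypothesis Z_rec : forall w v,
  Z (w, v) * (z - \sum_(u | e v u && (u != w)) Z (v, u)) = 1.

Let e_sym : symmetric e. Proof. by case: e_simple. Qed.
Let r_sym : symmetric r. Proof. by case: cover => [[[]]]. Qed.
Let r_irr : irreflexive r. Proof. by case: cover => [[[]]]. Qed.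
Let r_conn : connected_graph r. Proof. by case: cover => [[]]. Qed.
Let r_acyc : acyclic_graph r. Proof. by case: cover => [[]]. Qed.
Let p_surj v : exists x, p x = v. Proof. by case: cover => [_ []]. Qed.
Let p_adj x y : r x y -> e (p x) (p y).
Proof. by case: cover => [_ [_ h _]]; exact: h. Qed.
Let p_lift x w : e (p x) w -> exists y, r x y /\ p y = w.
Proof. by case: cover => [_ [_ _ h]] /h[y [yP _]]; exists y. Qed.
Let p_inj x y y' : r x y -> r x y' -> p y = p y' -> y = y'.
Proof.
case: cover => [_ [_ _ h]] xy xy' E; have [u [_ uu]] := h x _ (p_adj xy).
by rewrite -(uu y) // -(uu y').
Qed.

Let lift x w := xget x [set y | r x y /\ p y = w].
Let nbrs x := [seq lift x w | w <- enum (e (p x))].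

Let liftP x w : e (p x) w -> r x (lift x w) /\ p (lift x w) = w.
Proof. by move=> h; exact: (xgetPex x (p_lift h)). Qed.

Let nbrsP x y : (y \in nbrs x) = r x y.
Proof.
apply/mapP/idP => [[w]|xy]; first by rewrite mem_enum => /liftP[? _] ->.
exists (p y); first by rewrite mem_enum; exact: p_adj.
by have [? ?] := liftP (p_adj xy); exact: (p_inj xy).
Qed.

Let nbrs_uniq x : uniq (nbrs x).
Proof.
rewrite map_inj_in_uniq ?enum_uniq // => v w; rewrite !mem_enum.
by move=> /liftP[_ {2}<-] /liftP[_ {2}<-] ->.
Qed.

Let nbrs_size x : (size (nbrs x) <= #|V|)%N.
Proof. by rewrite size_map -cardE max_card. Qed.

Let nbrs_sum x (P : pred V) (F : V -> C) :
  \sum_(u <- nbrs x | P (p u)) F (p u) = \sum_(w | e (p x) w && P w) F w.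
Proof.
rewrite big_map big_enum_cond /=.
apply: eq_big => [w|w /andP[/liftP[_ ->]]] //.
by rewrite unfold_in; case h : (e (p x) w) => //=; have [_ ->] := liftP h.
Qed.

Let W x y := Z (p x, p y).

Let W_rec q x : r q x -> W q x * (z - \sum_(u <- nbrs x | u != q) W x u) = 1.
Proof.
move=> qx; rewrite -[RHS](Z_rec (p q) (p x)); congr (_ * (_ - _)).
rewrite -(nbrs_sum x (fun w => w != p q) (fun w => Z (p x, w))).
rewrite big_seq_cond [RHS]big_seq_cond; apply: eq_bigl => u.
case ux : (u \in nbrs x) => //=; rewrite nbrsP in ux; congr (~~ _).
apply/eqP/eqP => [-> //|]; apply: (p_inj ux); by rewrite r_sym.
Qed.

Definition self_energy v : C := z - \sum_(u | e v u) Z (v, u).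

Lemma self_energy_neq0 v : self_energy v != 0.
Proof.
apply/eqP => /(congr1 (fun c => complex.Im c * complex.Im z)).
rewrite ImD ImN Im_sum mulrDl mulNr mulr_suml mul0r => E.
have h1 : 0 < complex.Im z * complex.Im z by rewrite -expr2 exprn_even_gt0.
have h2 : \sum_(u | e v u) complex.Im (Z (v, u)) * complex.Im z <= 0.
  by apply: sumr_le0 => u _; exact: ltW.
lra.
Qed.

Lemma Z_self_energy w v : e w v -> Z (w, v) * (self_energy v + Z (v, w)) = 1.
Proof.
move=> wv; rewrite -[RHS](Z_rec w v) /self_energy (bigD1 w) /= 1?e_sym //.
by congr (_ * _); ring.
Qed.

(** The invariance of [G_arc] under edge reversal; both sides of the cross-multiplied equation are
    [1 - Z (w, v) * Z (v, w)]. *)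
Lemma Z_self_energy_sym w v : e w v ->
  Z (w, v) / self_energy w = Z (v, w) / self_energy v.
Proof.
move=> wv; have h1 := Z_self_energy wv.
have h2 : Z (v, w) * (self_energy w + Z (w, v)) = 1.
  by apply: Z_self_energy; rewrite e_sym.
have n1 := self_energy_neq0 w; have n2 := self_energy_neq0 v.
apply/eqP; rewrite eqr_div //; apply/eqP.
apply: (addIr (Z (w, v) * Z (v, w))).
by rewrite -mulrDr h1 [Z (w, v) * Z _]mulrC -mulrDr h2.
Qed.

Let root_all y : restr_root y nbrs z W xpredT = - (self_energy (p y))^-1.
Proof.
rewrite /restr_root -invrN /self_energy opprB addrC.
rewrite (nbrs_sum y xpredT (fun w => Z (p y, w))).
by under eq_bigl do rewrite andbT.
Qed.

(** The tree is rooted at the second argument [y] and not restricted. A neighbour of [y] is then a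
    child of the root, and its path product is a single weight. *)
Lemma green_diag_adj y :
  green r y y z = - (self_energy (p y))^-1 /\
  forall x, r x y -> green r x y z = - (Z (p y, p x) / self_energy (p y)).
Proof.
have E : resolvent (adj_op r) z (delta R y) =
    restr_green y r_conn nbrs z W xpredT.
  rewrite -(restr_green_resolvent r_sym r_irr r_conn r_acyc nbrsP nbrs_uniq
    nbrs_size
    z_neq0 (fun x y => Z_Im (p x, p y)) W_rec) //.
  congr (resolvent (adj_op _) _ _); apply/funext => a; apply/funext => b.
  by apply/propext; split=> [ab|[]].
rewrite /green E /restr_green root_all path_prod_root mulr1; split=> // x xy.
have yx : r y x by rewrite r_sym.
have dx : gdist y r_conn x = (gdist y r_conn y).+1.
  by have [//|[]] := adj_childVparent y r_sym r_irr r_conn r_acyc yx; rewrite eqxx.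
by rewrite (path_prod_child r_sym r_irr r_acyc W yx dx) path_prod_root mulr1
  mulNr mulrC.
Qed.

(** The tree is rooted at [y] and restricted to the branch, where [y] loses only the neighbour [x].
    The inverse of [restr_root] is then minus the bracket in the recursion for [W x y]. *)
Lemma green_branchE x y : r x y -> green_branch r y x y y z = - Z (p x, p y).
Proof.
move=> xy; pose B a := `[< branch r y x a >].
have nyx : y != x by apply: contraTneq xy => ->; rewrite r_irr.
have nBx : ~~ B x by apply/asboolPn; exact: branch_far_notin.
have By : B y by apply/asboolP; exists [::].
have adjB a b : B a -> r a b -> (a, b) != (y, x) -> (a, b) != (x, y) -> B b.
  move=> /asboolP[s [ps ls]] ab n1 n2; apply/asboolP; exists (rcons s b).
  by rewrite last_rcons rcons_path ps ls /del_edge ab n1 n2.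
(* The deleted edge is the only one leaving the branch, and its end in the branch is [y]. *)
have B_closed a b : a != y -> B a -> r a b -> B b.
  move=> ay Ba ab; apply: (adjB a) => //; rewrite xpair_eqE negb_and ?ay //.
  by rewrite (contraNneq _ nBx) // => <-.
have E : resolvent (adj_op (fun a b => [/\ branch r y x a, branch r y x b & r a b]))
    z (delta R y) = restr_green y r_conn nbrs z W B.
  rewrite -(restr_green_resolvent r_sym r_irr r_conn r_acyc nbrsP nbrs_uniq
    nbrs_size
    z_neq0 (fun x y => Z_Im (p x, p y)) W_rec By B_closed).
  congr (resolvent (adj_op _) _ _); apply/funext => a; apply/funext => b.
  by apply/propext; split=> -[/asboolP ? /asboolP ? ?].
rewrite /green_branch /green E /restr_green By path_prod_root mulr1 /restr_root.
rewrite (_ : \sum_(u <- nbrs y | B u) W y u =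
    \sum_(u <- nbrs y | u != x) W y u); last first.
  rewrite big_seq_cond [RHS]big_seq_cond; apply: eq_bigl => u.
  case uy : (u \in nbrs y) => //=; rewrite nbrsP in uy.
  apply/idP/idP => [Bu|ux]; first by apply: contraNneq nBx => <-.
  by apply: (adjB y) => //; rewrite xpair_eqE negb_and ?ux ?nyx ?orbT.
have h := W_rec xy.
have n0 : z - \sum_(u <- nbrs y | u != x) W y u != 0.
  by apply/eqP => E0; move/eqP: h; rewrite E0 mulr0 eq_sym oner_eq0.
rewrite addrC -opprB invrN; congr (- _).
by rewrite -[LHS]mul1r -h mulfK.
Qed.

(** The Green function was computed from the projection alone, so all lifts agree and the selection
    by [xget] is determined. *)
Lemma G_vertexE v : G_vertex r p z v = - (self_energy v)^-1.
Proof.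
apply: xget_unique => [|c [x <- ->]]; last by have [] := green_diag_adj x.
by have [x px] := p_surj v; exists x => //; rewrite -px;
  have [-> _] := green_diag_adj x.
Qed.

Let arc_lift w v : e w v -> exists x y, [/\ r x y, p x = w & p y = v].
Proof.
by have [x <-] := p_surj w => /p_lift[y [xy py]]; exists x, y.
Qed.

Lemma G_arcE w v : e w v -> G_arc r p z (w, v) = - (Z (v, w) / self_energy v).
Proof.
move=> wv; apply: xget_unique => [|c [x [y [xy [<- <-] ->]]]]; last first.
  by have [_ ->] := green_diag_adj y.
have [x [y [xy <- <-]]] := arc_lift wv; exists x, y; split=> //.
by have [_ ->] := green_diag_adj y.
Qed.

Lemma zetaE w v : e w v -> zeta r p z (w, v) = Z (w, v).
Proof.
move=> wv; apply: xget_unique => [|c [x [y [xy [<- <-] ->]]]]; last first.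
  by rewrite green_branchE // opprK.
have [x [y [xy <- <-]]] := arc_lift wv; exists x, y; split=> //.
by rewrite green_branchE // opprK.
Qed.

Lemma G_edgeE w v : e w v ->
  G_edge r p z [set w; v]%SET = - (Z (w, v) / self_energy w).
Proof.
move=> wv; rewrite Z_self_energy_sym //.
apply: xget_unique => [|c [x [y [xy E ->]]]].
  have [x [y [xy <- <-]]] := arc_lift wv; exists x, y; split=> //.
  by rewrite G_arcE //; exact: p_adj.
rewrite G_arcE; last exact: p_adj.
have nxy := p_adj xy.
have pne : p x != p y.
  by apply: contraTneq nxy => ->; case: e_simple => _ ->.
have : p x \in [set w; v]%SET by rewrite -E !inE eqxx.
have : p y \in [set w; v]%SET by rewrite -E !inE eqxx orbT.
(* The chosen arc is one of the two orientations of the edge; they agree by [Z_self_energy_sym]. *)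
rewrite !inE => /orP[] /eqP E1 /orP[] /eqP E2; rewrite ?E1 ?E2 //.
- by rewrite E1 E2 eqxx in pne.
- by rewrite Z_self_energy_sym.
- by rewrite E1 E2 eqxx in pne.
Qed.

End UniversalCover.

Theorem theorem1p5 (R : realType) (V : finType) (e : rel V)
    (e_simple : simple_graph e) (e_connected : connected_graph e)
    (e_degree : forall v : V, (2 <= #|[pred w | e v w]|)%N)
    (X : choiceType) (r : rel X) (p : X -> V)
    (cover : universal_cover r e p)
    (z : R[i]) (z_nonreal : z \isn't Num.real) :
  (\prod_(E in edges e) - G_edge r p z E) *
    det_op (fun (f : oriented_edge e -> R[i]) b =>
      (zeta r p z (val b))^-1 * f b - nonbacktracking_op f b) =
  det_op (fun (f : V -> R[i]) x => z * f x - vertex_op e f x) *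
    \prod_(x : V) - G_vertex r p z x.
Proof.
have z0 : complex.Im z != 0.
  by apply: contra z_nonreal; case: (z) => a b /=; rewrite complex_real.
have [e_sym e_irr] := e_simple.
have [Z [Z_Im Z_rec]] := zeta_exists e z0.
have S_neq0 := self_energy_neq0 e z0 Z_Im.
rewrite (_ : (fun (f : oriented_edge e -> R[i]) b =>
      (zeta r p z (val b))^-1 * f b - nonbacktracking_op f b) =
    (fun (f : oriented_edge e -> R[i]) b =>
      (Z (val b))^-1 * f b - nonbacktracking_op f b)); last first.
  apply/funext => f; apply/funext => -[[w v] /= wv].
  by rewrite (zetaE cover z0 Z_Im Z_rec).
rewrite (eq_bigr (fun v => (self_energy e z Z v)^-1)); last first.
  by move=> v _; rewrite (G_vertexE cover z0 Z_Im Z_rec) opprK.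
apply: (ihara_bass e_sym e_irr (g := fun E => - G_edge r p z E)) => //.
  exact: Z_self_energy.
by move=> w v wv; rewrite (G_edgeE e_simple cover z0 Z_Im Z_rec wv) opprK.
Qed.
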